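(* Assume the rank-1 model described in the context, that the community size $r$ is known, and that Assumption 3 holds. Fix $\epsilon>0$ and consider the scan test that rejects (outputs $1$) if and only if \[ T^{\mathsf u}:=\max_{D\subseteq V,\ r^{1/3}\le|D|\le r}T^{\mathsf u}_D\ \ge\ 1+\frac{\epsilon}{3}. \] This test is asymptotically powerful provided the following three conditions hold: $r=o(n)$; $\mathbb{E}_C[e(D^\star_C)]\to\infty$ for all $C\subseteq V$ with $|C|=r$; and for every $C\subseteq V$ with $|C|=r$, \[ \max_{\emptyset\ne D\subseteq C}\frac{\mathbb{E}_0[e(D)]\,h(\rho_C-1)}{|D|\log(n/|D|)}\ge1+\epsilon . \]
   Context: Rank-1 setting. For each $n$ let $V=\{1,\dots,n\}$ and let vertex weights $\theta_i\in(0,1)$ be given, with edge probabilities $p_{ij}=\theta_i\theta_j$ ($i\ne j$). Let $r=r_n$ be a community size, and for every $C\subseteq V$ with $|C|=r$ let $\rho_C>1$ with $\rho_Cp_{ij}\le1$ for $i,j\in C$. All may depend on $n$, and limits are as $n\to\infty$. Observe a simple undirected graph with adjacency matrix $A$. Under $\mathbb{P}_0$ the $A_{ij}$ ($i<j$) are independent $\mathrm{Bern}(p_{ij})$. Under $\mathbb{P}_C$ they are independent with $A_{ij}\sim\mathrm{Bern}(\rho_Cp_{ij})$ for $i,j\in C$ and $\mathrm{Bern}(p_{ij})$ otherwise. $\mathbb{E}_0,\mathbb{E}_C$ are the corresponding expectations. The edge probabilities (weights) are unknown to the test. The worst-case risk of a test $\psi_n$ is $R_n(\psi_n)=\mathbb{P}_0(\psi_n\ne0)+\max_{|C|=r}\mathbb{P}_C(\psi_n\ne1)$,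 and the test is asymptotically powerful if $R_n\to0$. Assumption 3. With $\theta_{\max}=\max_i\theta_i$ and $\theta_{\min}=\min_i\theta_i$: $(\theta_{\max}/\theta_{\min})^2=o\big(r^{2/3}\wedge\tfrac nr\theta_{\min}^2\big)$. Notation. $e(D)=\sum_{i<j,\ i,j\in D}A_{ij}$ and $e(D,-D)=\sum_{i\in D,j\notin D}A_{ij}$. $h(x)=(x+1)\log(x+1)-x$. $[x]_+=\max\{x,0\}$. $\widehat{E}_D=\tfrac14\big(\sqrt{e(V)}-\sqrt{e(V)-2e(D,-D)}\big)^2$ and $\widetilde E_D=\max\{\widehat E_D,\ \tfrac{|D|^2}{n}\log^4(n/|D|)\}$. $T^{\mathsf u}_D=\widetilde E_D\,h\big([e(D)/\widetilde E_D-1]_+\big)/(|D|\log(n/|D|))$. For $|C|=r$, $D^\star_C$ is a maximizer of $\frac{\mathbb{E}_0[e(D)]}{|D|\log(n/|D|)}$ over nonempty $D\subseteq C$. *)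

(* Defs.v *)
From HB Require Import structures.
From mathcomp Require Import all_boot all_order all_algebra.
From mathcomp Require Import all_classical all_reals all_analysis.
Set Implicit Arguments. Unset Strict Implicit. Unset Printing Implicit Defensive.
Import Order.TTheory GRing.Theory Num.Theory.
Local Open Scope classical_set_scope.
Local Open Scope ring_scope.

Section Defs.
Variable R : realType.

(* A simple undirected graph on V = 'I_n is encoded by the set of its edges
   (i,j) with i < j; sets containing other pairs get probability 0. *)
Definition graph n := {set 'I_n * 'I_n}.

Definition adj n (A : graph n) (i j : 'I_n) : bool :=
  ((i, j) \in A) || ((j, i) \in A).

Definition graphP n (q : 'I_n -> 'I_n -> R) (A : graph n) : R :=
  (\prod_(i : 'I_n) \prod_(j : 'I_n | (i < j)%N)
      (if (i, j) \in A then q i j else 1 - q i j))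
  * (if A \subset [set ij : 'I_n * 'I_n | (ij.1 < ij.2)%N] then 1 else 0).

Definition Prob n (q : 'I_n -> 'I_n -> R) (E : pred (graph n)) : R :=
  \sum_(A : graph n | E A) graphP q A.
Definition Ex n (q : 'I_n -> 'I_n -> R) (f : graph n -> R) : R :=
  \sum_(A : graph n) graphP q A * f A.

Definition p0 n (theta : 'I_n -> R) (i j : 'I_n) : R := theta i * theta j.
Definition pC n (theta : 'I_n -> R) (rhoC : R) (C : {set 'I_n}) (i j : 'I_n) : R :=
  if (i \in C) && (j \in C) then rhoC * (theta i * theta j) else theta i * theta j.

Definition eD n (D : {set 'I_n}) (A : graph n) : R :=
  \sum_(i in D) \sum_(j in D | (i < j)%N) (adj A i j)%:R.
Definition eDc n (D : {set 'I_n}) (A : graph n) : R :=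
  \sum_(i in D) \sum_(j in ~: D) (adj A i j)%:R.

Definition hfun (x : R) : R := (x + 1) * ln (x + 1) - x.

Definition Ehat n (D : {set 'I_n}) (A : graph n) : R :=
  4^-1 * (Num.sqrt (eD [set: 'I_n] A)
          - Num.sqrt (eD [set: 'I_n] A - 2 * eDc D A)) ^+ 2.

Definition Etilde n (D : {set 'I_n}) (A : graph n) : R :=
  Num.max (Ehat D A)
          ((#|D|%:R ^+ 2 / n%:R) * ln (n%:R / #|D|%:R) ^+ 4).

Definition Tu n (D : {set 'I_n}) (A : graph n) : R :=
  Etilde D A * hfun (Num.max (eD D A / Etilde D A - 1) 0)
  / (#|D|%:R * ln (n%:R / #|D|%:R)).

(* The scan test: rejects (true) iff max_{r^{1/3} <= |D| <= r} T^u_D >= 1 + eps/3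
   (a max over an empty family never exceeds the threshold). *)
Definition scan_test n (r : nat) (eps : R) (A : graph n) : bool :=
  [exists D : {set 'I_n},
     [&& ((r%:R : R) `^ (3^-1) <= #|D|%:R), (#|D| <= r)%N & (1 + eps / 3 <= Tu D A)]].

Definition risk n (theta : 'I_n -> R) (r : nat) (rho : {set 'I_n} -> R)
    (psi : graph n -> bool) : R :=
  Prob (p0 theta) psi
  + \big[Num.max/0]_(C : {set 'I_n} | #|C| == r)
        Prob (pC theta (rho C) C) (fun A => ~~ psi A).

Definition theta_max n (theta : 'I_n -> R) : R := \big[Num.max/0]_i theta i.
Definition theta_min n (theta : 'I_n -> R) : R := \big[Num.min/1]_i theta i.

Definition little_o (f g : nat -> R) : Prop :=
  forall delta : R, 0 < delta -> \forall n \near \oo, f n <= delta * g n.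

Definition assumption3 (theta : forall n, 'I_n -> R) (r : nat -> nat) : Prop :=
  little_o (fun n => (theta_max (theta n) / theta_min (theta n)) ^+ 2)
           (fun n => Num.min (((r n)%:R : R) `^ (2 / 3))
                       ((n%:R / (r n)%:R) * theta_min (theta n) ^+ 2)).

Definition dens_ratio n (theta : 'I_n -> R) (D : {set 'I_n}) : R :=
  Ex (p0 theta) (eD D) / (#|D|%:R * ln (n%:R / #|D|%:R)).

End Defs.

Arguments eD {R n}.
Arguments eDc {R n}.
Arguments Ehat {R n}.
Arguments Etilde {R n}.
Arguments Tu {R n}.

(* Main.v *)
(** Write [S] and [s] for the weights of [V] and [D], [mu] for [E_0 e(D)],
    [L = |D| log (n/|D|)], and [rate m e = e ln (e/m) - e + m] for the Poisson
    rate, so that [T_D = rate (Etilde D) e(D) / L] when [e(D) > Etilde D].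

    Null: Chernoff and a union bound over [D] give [rate mu e(D) <= (1 + eps/6) L]
    for all [D].  Replacing [e(V)] and [e(D,-D)] by [S^2/2] and [s (S - s)] in the
    plug-in estimator gives exactly [s^2/2 >= mu], so only fluctuations can make
    it fall below [mu].  When [mu] exceeds the second term of [Etilde], their
    relative size [eta] satisfies [eta^2 mu = o(L)], which is the precision at
    which [rate] changes by [o(L)].

    Alternative: comparing [D*] with [C] shows [|D*| >= r^(1/3)].  By duality
    [m h([e/m - 1]_+) >= e ln lambda - m (lambda - 1)] for every [lambda >= 1].
    If [Etilde] is close to [mu], take [lambda = rho]; otherwise [Etilde] is
    [(|D|^2/n) log^4 (n/|D|)], which forces [rho >= (n/|D|) / log^4 (n/|D|)], and
    [lambda = rho mu / Etilde] loses only a [log log] against [log rho]. *)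
Require Import Defs.
From HB Require Import structures.
From mathcomp Require Import all_boot all_order all_algebra.
From mathcomp Require Import all_classical all_reals all_analysis.
From mathcomp Require Import ring lra.
Set Implicit Arguments. Unset Strict Implicit. Unset Printing Implicit Defensive.
Import Order.TTheory GRing.Theory Num.Theory.
Import numFieldNormedType.Exports.
Local Open Scope classical_set_scope.
Local Open Scope ring_scope.

(** * Edge counts under a product measure *)

(** Every estimate is made at a fixed [n]: one number [delta] bounds all the small ratios in the
    hypotheses, [ln delta^-1] bounds every [log (n/|D|)] from below, and [exp (- M)] is the
    probability granted to a bad event. Limits occur only in the final theorem. The obstacle is that
    [mu] may be much larger than [L], so a small relative error [eta] of the estimator need not be
    small on the scale of [L]. What saves the test is that the rate is quadratic near [e = mu]: the
    error changes it by about [eta (e - mu) + eta^2 mu], and [(e - mu)^2 <= 4 e (rate mu e)]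
    controls the first part. Uniformly over [D], the count [e(D,-D)] fluctuates with [eta^2] of
    order [L / (s S)], so [eta^2 mu] is of order [L s / S], and [assumption3] makes [s / S] small.
    The second term of [Etilde] serves the sets where [L / (s S)] itself need not be small: there it
    exceeds [mu] without any concentration. Under the alternative the community also inflates
    [e(D,-D)]. This bias need not satisfy [eta^2 mu = o(L)]; it is controlled by
    [rho theta_min^2 <= 1] and charged directly to [h(rho - 1)]. *)

Definition upper {n} (e : 'I_n * 'I_n) : bool := (e.1 < e.2)%N.

Definition edge_count {R : realType} {n} (w : pred ('I_n * 'I_n)) (A : graph n) : R :=
  \sum_(e | upper e && w e) (e \in A)%:R.

Section GraphMeasure.
Variables (R : realType) (n : nat) (q : 'I_n -> 'I_n -> R).

(** [bigA_distr] expands a product of binary sums over all subsets. Giving a pair outside [upper]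
    weight 0 when present and 1 when absent reproduces the support indicator of [graphP]. Means and
    moment generating functions both come from this formula. *)
Lemma sum_graphP_prod (f : 'I_n * 'I_n -> bool -> R) :
  \sum_(A : graph n) graphP q A * \prod_(e | upper e) f e (e \in A) =
  \prod_(e | upper e) (q e.1 e.2 * f e true + (1 - q e.1 e.2) * f e false).
Proof.
pose F e : R := if upper e then q e.1 e.2 * f e true else 0.
pose G e : R := if upper e then (1 - q e.1 e.2) * f e false else 1.
have -> : \prod_(e | upper e)
    (q e.1 e.2 * f e true + (1 - q e.1 e.2) * f e false) =
    \prod_e (F e + G e).
  rewrite big_mkcond /=; apply: eq_bigr => e _; rewrite /F /G.
  by case: ifP => // _; rewrite add0r.
rewrite bigA_distr; apply: eq_bigr => A _.
rewrite [RHS](bigID upper) /= /graphP.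
have -> : \prod_(i | ~~ upper i) (if i \in A then F i else G i) =
    if A \subset [set ij : 'I_n * 'I_n | (ij.1 < ij.2)%N] then 1 else 0.
  case: ifP => [/fintype.subsetP AU|/negbT/subsetPn[e eA nue]].
    rewrite big1// => e nue; rewrite /G (negPf nue).
    by case: ifP => // /AU/set_mem ue; rewrite /upper ue in nue.
  have {}nue : ~~ upper e by apply: contra nue => ue; apply/mem_set.
  by rewrite (bigD1 e)//= eA /F (negPf nue) mul0r.
rewrite mulrAC; congr (_ * _).
rewrite pair_big_dep/= -big_split/=; apply: eq_bigr => -[i j] /= ue.
by rewrite /F /G /upper/= ue; case: ifP.
Qed.

Lemma graphP_support (A : graph n) :
  (forall e, e \in A -> upper e) \/ graphP q A = 0.
Proof.
rewrite /graphP; case: ifP => [/fintype.subsetP AU|_]; last by right; rewrite mulr0.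
by left => e /AU/set_mem.
Qed.

Lemma eq_Ex (f g : graph n -> R) :
  (forall A : graph n, (forall e, e \in A -> upper e) -> f A = g A) ->
  Ex q f = Ex q g.
Proof.
move=> fg; apply: eq_bigr => A _.
by have [/fg->|->] := graphP_support A; rewrite ?mul0r.
Qed.

Definition edge_mean (w : pred ('I_n * 'I_n)) : R :=
  \sum_(e | upper e && w e) q e.1 e.2.

Lemma Ex_edge_count w : Ex q (edge_count w) = edge_mean w.
Proof.
rewrite /Ex /edge_count.
under eq_bigr => A _ do rewrite mulr_sumr.
rewrite exchange_big /=; apply: eq_bigr => e0 /andP[u0 _].
(* The test function is the indicator of [e0] and 1 at every other pair, whose factor is then
   [q + (1 - q) = 1]. *)
have := sum_graphP_prod (fun e b => if e == e0 then b%:R else 1).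
rewrite [RHS](bigD1 e0)//= eqxx mulr1 mulr0 addr0 [X in _ * X]big1 ?mulr1; last first.
  by move=> e /andP[_ /negPf ->]; rewrite !mulr1 addrC subrK.
move=> <-; apply: eq_bigr => A _; congr (_ * _).
rewrite (bigD1 e0)//= eqxx big1 ?mulr1// => e /andP[_ /negPf ->] //.
Qed.

Hypothesis q01 : forall i j : 'I_n, (i < j)%N -> 0 <= q i j <= 1.

Lemma graphP_ge0 A : 0 <= graphP q A.
Proof.
rewrite /graphP mulr_ge0//; last by case: ifP.
apply: prodr_ge0 => i _; apply: prodr_ge0 => j ij.
by have /andP[q0 q1] := q01 ij; case: ifP; rewrite ?subr_ge0.
Qed.

(** Markov's inequality, the common root of the union and Chernoff bounds. Domination is asked only
    on well-formed graphs, since all others have probability zero. *)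
Lemma Prob_le_Ex (E : pred (graph n)) (f : graph n -> R) :
  (forall A, 0 <= f A) ->
  (forall A : graph n, (forall e, e \in A -> upper e) -> E A -> 1 <= f A) ->
  Prob q E <= Ex q f.
Proof.
move=> f0 f1; rewrite /Prob /Ex [leLHS]big_mkcond/=; apply: ler_sum => A _.
case: ifP => EA; last by rewrite mulr_ge0// graphP_ge0.
have [AU|->] := graphP_support A; last by rewrite mul0r.
by rewrite ler_peMr ?graphP_ge0// f1.
Qed.

Lemma Prob_subset (E F : pred (graph n)) :
  (forall A : graph n, (forall e, e \in A -> upper e) -> E A -> F A) ->
  Prob q E <= Prob q F.
Proof.
move=> EF; apply: (le_trans (Prob_le_Ex (f := fun A => (F A)%:R) _ _)) => //.
  by move=> A AU /(EF A AU) ->.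
rewrite /Ex /Prob [leRHS]big_mkcond; apply: ler_sum => A _.
by case: ifP => _; rewrite ?mulr1 ?mulr0.
Qed.

Lemma Prob_ge0 E : 0 <= Prob q E.
Proof. by apply: sumr_ge0 => A _; apply: graphP_ge0. Qed.

Lemma Prob_exists_le (I : finType) (P : pred I) (E : I -> pred (graph n)) :
  Prob q (fun A => [exists i, P i && E i A]) <= \sum_(i | P i) Prob q (E i).
Proof.
apply: (le_trans (Prob_le_Ex (f := fun A => \sum_(i | P i) (E i A)%:R) _ _)) => //.
- by move=> A; apply: sumr_ge0.
- move=> A _ /existsP[i /andP[Pi EiA]].
  by rewrite (bigD1 i)//= EiA lerDl sumr_ge0.
rewrite /Ex; under eq_bigr => A _ do rewrite mulr_sumr.
rewrite exchange_big/=; apply: ler_sum => i _.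
rewrite /Prob [leRHS]big_mkcond; apply: ler_sum => A _.
by case: ifP => _; rewrite ?mulr1 ?mulr0.
Qed.

Lemma Prob_or_le (E F : pred (graph n)) :
  Prob q (fun A => E A || F A) <= Prob q E + Prob q F.
Proof.
apply: (le_trans (Prob_le_Ex (f := fun A => (E A)%:R + (F A)%:R) _ _)) => //.
- by move=> A _; case: (E A); case: (F A); rewrite ?lerDl ?lerDr.
rewrite /Ex; under eq_bigr => A _ do rewrite mulrDr.
rewrite big_split/= lerD// /Prob [leRHS]big_mkcond; apply: ler_sum => A _;
by case: ifP => _; rewrite ?mulr1 ?mulr0.
Qed.

(** Comparison with a Poisson variable of the same mean: each edge contributes
    [1 + q (e^t - 1) <= exp (q (e^t - 1))]. *)
Lemma Ex_expR_edge_count w t :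
  Ex q (fun A => expR (t * edge_count w A)) <= expR (edge_mean w * (expR t - 1)).
Proof.
pose f e (b : bool) := expR (t * (w e && b)%:R).
rewrite /Ex; under eq_bigr => A _.
  rewrite /edge_count big_mkcondr/= mulr_sumr expR_sum.
  rewrite (eq_bigr (fun e => f e (e \in A))); last first.
    by move=> e _; rewrite /f; case: (w e).
  over.
rewrite sum_graphP_prod /edge_mean big_mkcondr/= mulr_suml expR_sum.
apply: ler_prod => e ue; have /andP[q0 q1] := q01 ue.
rewrite addr_ge0 ?mulr_ge0 ?expR_ge0 ?subr_ge0//= /f.
case: (w e); last by rewrite mulr0 expR0 !mulr1 mul0r expR0 addrC subrK.
rewrite mulr1 mulr0 expR0 mulr1; apply: le_trans (expR_ge1Dx _).
by rewrite mulrBr; lra.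
Qed.

(** Chernoff at the Poisson optimum [t = ln (y / m)]. As [t >= 0], an upper bound on the mean
    suffices. *)
Lemma Prob_edge_count_ge w (m y : R) : edge_mean w <= m -> 0 < m -> m <= y ->
  Prob q (fun A => y <= edge_count w A) <= expR (- (y * ln (y / m) - y + m)).
Proof.
move=> wm m0 my; have y0 : 0 < y by apply: lt_le_trans my.
pose t := ln (y / m).
have t0 : 0 <= t by rewrite ln_ge0// ler_pdivlMr// mul1r.
have Et : expR t = y / m by rewrite lnK// posrE divr_gt0.
apply: (@le_trans _ _ (Ex q (fun A => expR (t * edge_count w A)) * expR (- (t * y)))).
  rewrite /Ex mulr_suml; under eq_bigr => A _ do rewrite -mulrA -expRD.
  apply: Prob_le_Ex => [A|A _ yA]; first exact: expR_ge0.
  by rewrite -expR0 ler_expR subr_ge0 ler_wpM2l.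
apply: (@le_trans _ _ (expR (m * (expR t - 1)) * expR (- (t * y)))).
  rewrite ler_wpM2r ?expR_ge0//; apply: (le_trans (Ex_expR_edge_count _ _)).
  by rewrite ler_expR ler_wpM2r// subr_ge0 -expR0 ler_expR.
rewrite -expRD ler_expR Et mulrBr mulrCA divff ?gt_eqF// -/t; lra.
Qed.

Lemma Prob_edge_count_le w (m y : R) : m <= edge_mean w -> 0 < y -> y <= m ->
  Prob q (fun A => edge_count w A <= y) <= expR (- (y * ln (y / m) - y + m)).
Proof.
move=> wm y0 ym; have m0 : 0 < m by apply: lt_le_trans ym.
pose t := ln (y / m).
have t0 : t <= 0 by rewrite ln_le0// ler_pdivrMr// mul1r.
have Et : expR t = y / m by rewrite lnK// posrE divr_gt0.
apply: (@le_trans _ _ (Ex q (fun A => expR (t * edge_count w A)) * expR (- (t * y)))).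
  rewrite /Ex mulr_suml; under eq_bigr => A _ do rewrite -mulrA -expRD.
  apply: Prob_le_Ex => [A|A _ yA]; first exact: expR_ge0.
  by rewrite -expR0 ler_expR subr_ge0 ler_wnM2l.
apply: (@le_trans _ _ (expR (m * (expR t - 1)) * expR (- (t * y)))).
  rewrite ler_wpM2r ?expR_ge0//; apply: (le_trans (Ex_expR_edge_count _ _)).
  by rewrite ler_expR ler_wnM2r// subr_le0 -expR0 ler_expR.
rewrite -expRD ler_expR Et mulrBr mulrCA divff ?gt_eqF// -/t; lra.
Qed.

End GraphMeasure.

(** * Edge counts of vertex sets as sums over ordered pairs *)

Section EdgeSums.
Variables (R : realType) (n : nat).
Implicit Types (D C : {set 'I_n}) (A : graph n).

Definition inside D : pred ('I_n * 'I_n) := fun e => (e.1 \in D) && (e.2 \in D).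
Definition across D : pred ('I_n * 'I_n) := fun e => (e.1 \in D) (+) (e.2 \in D).

Lemma sum_inside (F : 'I_n -> 'I_n -> R) D :
  \sum_(i in D) \sum_(j in D | (i < j)%N) F i j =
  \sum_(e | upper e && inside D e) F e.1 e.2.
Proof.
rewrite pair_big_dep/=; apply: eq_bigl => -[i j] /=.
by rewrite /upper /inside /= andbA andbC.
Qed.

Lemma sum_lower (F : 'I_n -> 'I_n -> R) (P : rel 'I_n) :
  \sum_(e : 'I_n * 'I_n | (e.2 < e.1)%N && P e.1 e.2) F e.1 e.2 =
  \sum_(e : 'I_n * 'I_n | (e.1 < e.2)%N && P e.2 e.1) F e.2 e.1.
Proof.
pose sw (e : 'I_n * 'I_n) := (e.2, e.1).
rewrite (reindex_inj (h := sw)) //=.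
by apply: (can_inj (g := sw)) => -[].
Qed.

Lemma sum_across (F : 'I_n -> 'I_n -> R) D : (forall i j, F i j = F j i) ->
  \sum_(i in D) \sum_(j in ~: D) F i j =
  \sum_(e | upper e && across D e) F e.1 e.2.
Proof.
move=> Fsym; rewrite pair_big_dep/=.
rewrite (bigID upper) [in RHS](bigID (fun e => e.1 \in D)) /=; congr (_ + _).
  apply: eq_bigl => -[i j]; rewrite /upper /across !inE /=.
  by case: (i \in D); case: (j \in D); rewrite /= ?andbT ?andbF.
transitivity (\sum_(e : 'I_n * 'I_n | (e.2 < e.1)%N && ((e.1 \in D) && (e.2 \notin D)))
   F e.1 e.2).
  apply: eq_bigl => -[i j]; rewrite /upper !inE /= -leqNgt leq_eqVlt.
  case: eqVneq => [/val_inj ->|] /=; first by rewrite ltnn; case: (i \in D).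
  by rewrite andbC.
rewrite (sum_lower F (fun i j => (i \in D) && (j \notin D)))/=.
apply: eq_big => [[i j]|[i j] _]; last exact: Fsym.
rewrite /upper /across /=.
by case: (i \in D); case: (j \in D); rewrite /= ?andbT ?andbF.
Qed.

(** Source of the diagonal correction: the plug-in estimator targets [s^2/2], which exceeds [mu] by
    half the sum of the squared weights. *)
Lemma sqr_sum_inside (x : 'I_n -> R) D :
  (\sum_(i in D) x i) ^+ 2 =
  2 * (\sum_(e | upper e && inside D e) x e.1 * x e.2) + \sum_(i in D) x i ^+ 2.
Proof.
rewrite expr2 mulr_suml; under eq_bigr => i _ do rewrite mulr_sumr.
rewrite pair_big/= (bigID upper)/= mulr_natl mulr2n -addrA; congr (_ + _).
  by apply: eq_bigl => -[i j]; rewrite andbC.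
rewrite (bigID (fun e : 'I_n * 'I_n => (e.2 < e.1)%N))/=; congr (_ + _).
  transitivity (\sum_(e : 'I_n * 'I_n | (e.2 < e.1)%N && ((e.1 \in D) && (e.2 \in D)))
   x e.1 * x e.2).
    apply: eq_bigl => -[i j]; rewrite /upper /= -leqNgt andbC.
    by case: (boolP (j < i)%N) => //= ji; rewrite (ltnW ji) andbT.
  rewrite (sum_lower (fun i j => x i * x j) (fun i j => (i \in D) && (j \in D)))/=.
  apply: eq_big => [[i j]|[i j] _]; last exact: mulrC.
  by rewrite /upper /inside /= [(j \in D) && _]andbC.
rewrite [RHS](eq_bigr (fun i => \sum_(j | j == i) x i * x j)); last first.
  by move=> i _; rewrite big_pred1_eq.
rewrite pair_big_dep/=; apply: eq_bigl => -[i j]; rewrite /upper /=.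
rewrite -!leqNgt -andbA -eqn_leq.
have -> : (val j == val i) = (j == i) by [].
by have [->|] := eqVneq j i; rewrite ?andbF// !andbT andbb.
Qed.

Lemma adjC A i j : adj A i j = adj A j i.
Proof. by rewrite /adj orbC. Qed.

Lemma adj_upper A e : (forall e, e \in A -> upper e) -> upper e ->
  adj A e.1 e.2 = (e \in A).
Proof.
case: e => i j AU ij /=; rewrite /adj orbC; case: (boolP ((j, i) \in A)) => // /AU.
by rewrite /upper/= in ij *; rewrite ltnNge ltnW.
Qed.

Lemma eDE D A : (forall e, e \in A -> upper e) ->
  eD D A = edge_count (inside D) A :> R.
Proof.
move=> AU; rewrite /eD (sum_inside (fun i j => (adj A i j)%:R)).
by apply: eq_bigr => e /andP[ue _]; rewrite adj_upper.
Qed.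

Lemma eDcE D A : (forall e, e \in A -> upper e) ->
  eDc D A = edge_count (across D) A :> R.
Proof.
move=> AU; rewrite /eDc (sum_across (F := fun i j => (adj A i j)%:R)); last first.
  by move=> i j; rewrite adjC.
by apply: eq_bigr => e /andP[ue _]; rewrite adj_upper.
Qed.

Lemma eD_ge0 D A : 0 <= eD D A :> R.
Proof. by apply: sumr_ge0 => i _; apply: sumr_ge0. Qed.

Lemma eDc_ge0 D A : 0 <= eDc D A :> R.
Proof. by apply: sumr_ge0 => i _; apply: sumr_ge0. Qed.

Lemma eDc_le_eD D A : (forall e, e \in A -> upper e) ->
  eDc D A <= eD [set: 'I_n] A :> R.
Proof.
move=> AU; rewrite eDcE// eDE// /edge_count.
rewrite big_mkcondr [leRHS]big_mkcondr; apply: ler_sum => e _.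
by rewrite /inside !inE/=; case: ifP.
Qed.

Lemma Ex_eD (q : 'I_n -> 'I_n -> R) D :
  Ex q (eD D) = edge_mean q (inside D).
Proof. by rewrite -Ex_edge_count; apply: eq_Ex => A /eDE. Qed.

End EdgeSums.

(** * The Poisson rate *)

Section Rate.
Variable R : realType.
Implicit Types a b e m l t x y z rho eta : R.

(* The Cramer rate: a Poisson variable of mean [m] reaches the level [e] with
   probability about [exp (- rate m e)]. *)
Definition rate m e : R := e * ln (e / m) - e + m.

Lemma le_of_eq x y : x = y -> x <= y.
Proof. by move=> ->. Qed.

Lemma ln_le_subr1 x : 0 < x -> ln x <= x - 1.
Proof. by move=> x0; have := @le_ln1Dx R (x - 1); rewrite [1 + _]addrC subrK; apply; lra. Qed.

Lemma ln_ge_subV x : 0 < x -> 1 - x^-1 <= ln x.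
Proof.
move=> x0; have := @ln_le_subr1 x^-1; rewrite invr_gt0 => /(_ x0).
by rewrite lnV ?posrE//; lra.
Qed.

Lemma ln_div_split x y : 0 < x -> 0 < y -> ln (x / y) = ln x - ln y.
Proof. by move=> x0 y0; rewrite ln_div ?posrE. Qed.

(** Legendre duality, with equality at [l = e / m]; it is [ln x <= x - 1] at [x = l m / e]. *)
Lemma rate_ge_dual m e l : 0 < m -> 0 < e -> 0 < l ->
  e * ln l - m * (l - 1) <= rate m e.
Proof.
move=> m0 e0 l0; rewrite /rate ln_div_split//.
have := @ln_le_subr1 (l * m / e); rewrite !divr_gt0 ?mulr_gt0// => /(_ isT).
rewrite ln_div ?posrE ?mulr_gt0// lnM ?posrE// -(ler_pM2l e0).
rewrite (mulrBr e (l * m / e)) [e * (_ / e)]mulrC divfK ?gt_eqF//; lra.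
Qed.

(** This is [ln x >= 1 - 1/x] at [x = sqrt e / sqrt m]. It holds on both sides of [m], so both tails
    get their quadratic bound from it. *)
Lemma rate_ge_hellinger m e : 0 < m -> 0 < e ->
  (Num.sqrt e - Num.sqrt m) ^+ 2 <= rate m e.
Proof.
move=> m0 e0.
have w0 : 0 < Num.sqrt e by rewrite sqrtr_gt0.
have v0 : 0 < Num.sqrt m by rewrite sqrtr_gt0.
have we : e = Num.sqrt e ^+ 2 by rewrite sqr_sqrtr// ltW.
have vm : m = Num.sqrt m ^+ 2 by rewrite sqr_sqrtr// ltW.
have := @ln_ge_subV (Num.sqrt e / Num.sqrt m); rewrite divr_gt0// => /(_ isT).
have -> : rate m e = 2 * (e * ln (Num.sqrt e / Num.sqrt m)) - e + m.
  rewrite /rate (_ : ln (e / m) = 2 * ln (Num.sqrt e / Num.sqrt m)); first by ring.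
  by rewrite {1}we {1}vm -expr_div_n lnXn ?divr_gt0// mulr_natl.
rewrite -(ler_pM2l e0) invf_div mulrBr mulr1.
have -> : e * (Num.sqrt m / Num.sqrt e) = Num.sqrt e * Num.sqrt m.
  by rewrite {1}we; field; rewrite gt_eqF.
rewrite sqrrB -we -vm mulr2n; lra.
Qed.

Lemma rate_ge0 m e : 0 < m -> 0 < e -> 0 <= rate m e.
Proof.
by move=> m0 e0; apply: le_trans (rate_ge_hellinger m0 e0); rewrite sqr_ge0.
Qed.

Lemma sqr_sub_le_rate m e : 0 < m -> m <= e -> (e - m) ^+ 2 <= 4 * e * rate m e.
Proof.
move=> m0 me; have e0 : 0 < e by apply: lt_le_trans me.
have rg := rate_ge_hellinger m0 e0.
have w0 : 0 < Num.sqrt e by rewrite sqrtr_gt0.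
have v0 : 0 < Num.sqrt m by rewrite sqrtr_gt0.
have wv : Num.sqrt m <= Num.sqrt e by rewrite ler_sqrt// ltW.
have we : e = Num.sqrt e ^+ 2 by rewrite sqr_sqrtr// ltW.
have vm : m = Num.sqrt m ^+ 2 by rewrite sqr_sqrtr// ltW.
have -> : (e - m) ^+ 2 =
   (Num.sqrt e - Num.sqrt m) ^+ 2 * (Num.sqrt e + Num.sqrt m) ^+ 2.
  by rewrite {1}we {1}vm subr_sqr exprMn.
rewrite mulrC; apply: ler_pM; rewrite ?sqr_ge0//.
by rewrite [leRHS](_ : _ = 4 * Num.sqrt e ^+ 2) -?we//; nra.
Qed.

(** With [e <= 2 m], [sqr_sub_le_rate] gives the denominator 8; 9 is a common value that also covers
    the lower tail. *)
Lemma rate_ge_up m t : 0 < m -> 0 <= t <= 1 -> t ^+ 2 * m / 9 <= rate m ((1 + t) * m).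
Proof.
move=> m0 /andP[t0 t1]; have e0 : m <= (1 + t) * m by nra.
have := sqr_sub_le_rate m0 e0.
have -> : (1 + t) * m - m = t * m by ring.
have r0 : 0 <= rate m ((1 + t) * m) by rewrite rate_ge0//; lra.
move: (rate _ _) r0 => r r0 H; rewrite -(ler_pM2l m0).
have -> : m * (t ^+ 2 * m / 9) = (t * m) ^+ 2 / 9 by field.
have : 4 * ((1 + t) * m) * r <= 8 * m * r by rewrite ler_wpM2r//; nra.
have : 0 <= m * r by rewrite mulr_ge0// ltW.
lra.
Qed.

Lemma rate_ge_lo m t : 0 < m -> 0 <= t < 1 -> t ^+ 2 * m / 9 <= rate m ((1 - t) * m).
Proof.
move=> m0 /andP[t0 t1]; have e0 : 0 < (1 - t) * m by nra.
apply: le_trans (rate_ge_hellinger m0 e0).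
have v0 : 0 < Num.sqrt m by rewrite sqrtr_gt0.
have vm : m = Num.sqrt m ^+ 2 by rewrite sqr_sqrtr// ltW.
rewrite sqrtrM; last by lra.
have -> : Num.sqrt (1 - t) * Num.sqrt m - Num.sqrt m =
          (Num.sqrt (1 - t) - 1) * Num.sqrt m by ring.
rewrite exprMn -vm mulrAC ler_wpM2r ?(ltW m0)//.
have u0 : 0 < Num.sqrt (1 - t) by rewrite sqrtr_gt0; lra.
have : Num.sqrt (1 - t) ^+ 2 = 1 - t by rewrite sqr_sqrtr//; lra.
move: (Num.sqrt _) u0 => u u0 ut; have tu : t = 1 - u ^+ 2 by lra.
rewrite tu in t0 * => {ut tu}.
have -> : (1 - u ^+ 2) ^+ 2 = (u - 1) ^+ 2 * (1 + u) ^+ 2 by ring.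
have u1 : u <= 1.
  by rewrite leNgt; apply/negP => u1; have : 1 < u ^+ 2 by [rewrite expr_gt1// ltW]; lra.
rewrite -mulrA ler_piMr ?sqr_ge0// ler_pdivrMr// mul1r.
by have : u ^+ 2 <= 1; [rewrite expr_le1// ltW | nra].
Qed.

Lemma rate_nincr m m' e : 0 < m' -> m' <= m -> m <= e -> rate m e <= rate m' e.
Proof.
move=> m'0 m'm me; have m0 : 0 < m by apply: lt_le_trans m'm.
have e0 : 0 < e by apply: lt_le_trans me.
rewrite /rate !ln_div_split//.
have := @ln_ge_subV (m / m'); rewrite divr_gt0// => /(_ isT).
rewrite ln_div_split// invf_div => H.
have {}H : e * (1 - m' / m) <= e * (ln m - ln m') by rewrite ler_pM2l.
suff : m - m' <= e * (1 - m' / m) by lra.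
have -> : m - m' = m * (1 - m' / m) by field; rewrite gt_eqF.
by rewrite ler_wpM2r// subr_ge0 ler_pdivrMr// mul1r.
Qed.

(** The rate decreases in the mean up to [e], so the worst case is [m = (1 - eta) x]. There the loss
    is of first order in [eta] only through [e - x]; at [e = x] it is quadratic. *)
Lemma rate_perturb m x eta e : 0 < x -> 0 <= eta <= 2^-1 -> (1 - eta) * x <= m ->
  m <= e ->
  rate m e <= (if x <= e then rate x e + 2 * eta * (e - x) else 0) + 2 * eta ^+ 2 * x.
Proof.
move=> x0 /andP[eta0 eta1] xm me.
have y0 : 0 < (1 - eta) * x by nra.
have m0 : 0 < m by apply: lt_le_trans xm.
have e0 : 0 < e by apply: lt_le_trans me.
apply: (le_trans (rate_nincr y0 xm me)).
have i0 : (1 - eta)^-1 <= 2 by rewrite -[leRHS]invrK lef_pV2 ?posrE//; lra.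
have i1 : 0 < (1 - eta)^-1 by rewrite invr_gt0; lra.
have ie : (1 - eta) * (1 - eta)^-1 = 1 by rewrite divff// gt_eqF//; lra.
case: ifP => [xe|/negbT]; last rewrite -ltNge => ex.
  have : - ln (1 - eta) <= eta * (1 - eta)^-1.
    have := @ln_ge_subV (1 - eta).
    have -> : 0 < 1 - eta by lra.
    move=> /(_ isT); set v := (1 - eta)^-1 in i0 i1 ie *; nra.
  rewrite /rate !ln_div_split// lnM ?posrE//; last by lra.
  set L := ln (1 - eta); set v := (1 - eta)^-1 in i0 i1 ie *.
  rewrite -(ler_pM2l e0) => H.
  have -> : e * (ln e - (L + ln x)) = e * (ln e - ln x) + e * (- L) by ring.
  have K : eta * v * (e - x + eta * x) <= eta * 2 * (e - x + eta * x).
    by apply: ler_wpM2r; [nra | rewrite ler_wpM2l].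
  have : e * (eta * v) - eta * x = eta * v * (e - x + eta * x).
    have K2 : eta * x = eta * ((1 - eta) * v) * x by rewrite ie; ring.
    by rewrite {1}K2; ring.
  lra.
rewrite add0r /rate.
have := @ln_le_subr1 (e / ((1 - eta) * x)); rewrite divr_gt0// => /(_ isT).
rewrite -(ler_pM2l e0); set y := (1 - eta) * x in y0 xm *.
have ye : y <= e by apply: le_trans me.
(* Now [e] lies between [y] and [x], so [e - y <= eta x], and the rate is at most its chi-square
   bound. *)
move=> H; apply: (@le_trans _ _ ((e - y) ^+ 2 / y)).
  have -> : (e - y) ^+ 2 / y = e * (e / y - 1) - e + y by field; rewrite gt_eqF.
  lra.
rewrite ler_pdivrMr//.
have yE : y = x - eta * x by rewrite /y; ring.
have : (e - y) ^+ 2 <= (eta * x) ^+ 2.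
  by rewrite lerXn2r ?nnegrE ?subr_ge0// ?mulr_ge0 ?(ltW x0)// yE; lra.
have : (eta * x) ^+ 2 <= 2 * eta ^+ 2 * x * y.
  have -> : 2 * eta ^+ 2 * x * y = (eta * x) ^+ 2 * (2 * (1 - eta)) by rewrite /y; ring.
  by rewrite ler_peMr ?sqr_ge0//; lra.
lra.
Qed.

Lemma hfun_subr1 rho : hfun (rho - 1) = rho * ln rho - rho + 1.
Proof. by rewrite /hfun subrK; ring. Qed.

Lemma hfun_rate1 rho : hfun (rho - 1) = rate 1 rho.
Proof. by rewrite hfun_subr1 /rate divr1. Qed.

Lemma hfun_ge0 rho : 1 <= rho -> 0 <= hfun (rho - 1).
Proof. by move=> h; rewrite hfun_rate1 rate_ge0//; lra. Qed.

Lemma sqr_sub1_le_hfun rho : 1 <= rho -> (rho - 1) ^+ 2 <= 4 * rho * hfun (rho - 1).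
Proof. by move=> h; rewrite hfun_rate1 sqr_sub_le_rate. Qed.

Lemma hfun_le_mul_ln rho : 1 <= rho -> hfun (rho - 1) <= rho * ln rho.
Proof. by move=> h; rewrite hfun_subr1; lra. Qed.

Lemma mul_hfunE m e : 0 < m -> 0 <= e ->
  m * hfun (Num.max (e / m - 1) 0) = if m < e then rate m e else 0.
Proof.
move=> m0 e0; case: ltP => me.
  rewrite max_l ?subr_ge0 ?ler_pdivlMr ?mul1r ?ltW// hfun_subr1 /rate.
  by field; rewrite gt_eqF.
rewrite max_r; last by rewrite subr_le0 ler_pdivrMr// mul1r.
by rewrite /hfun add0r ln1; ring.
Qed.

(** For [e <= m] the left side is nonpositive, because [0 <= ln l <= l - 1]. The alternative thus
    never has to show that [e(D)] exceeds the estimate. *)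
Lemma mul_hfun_ge_dual m e l : 0 < m -> 0 <= e -> 1 <= l ->
  e * ln l - m * (l - 1) <= m * hfun (Num.max (e / m - 1) 0).
Proof.
move=> m0 e0 l1; have l0 : 0 < l by lra.
rewrite mul_hfunE//; case: ltP => me; first by apply: rate_ge_dual => //; lra.
have := ln_le_subr1 l0; have := ln_ge0 l1; nra.
Qed.

(** The equation [sqrt a - sqrt (a - 2 b) = z] is solved by [b = z sqrt a - z^2/2], so a bound on
    the estimator becomes a bound on [b]. If [a - 2 b < 0], the root is 0 by convention and the
    inequality persists. *)
Lemma sqrt_diff_ge a b z : 0 <= a -> 0 <= z -> z ^+ 2 <= a ->
  z * Num.sqrt a - z ^+ 2 / 2 <= b ->
  z ^+ 2 / 4 <= 4^-1 * (Num.sqrt a - Num.sqrt (a - 2 * b)) ^+ 2.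
Proof.
move=> a0 z0 za zb; have w0 := sqrtr_ge0 a.
have wa : Num.sqrt a ^+ 2 = a by rewrite sqr_sqrtr.
have zw : z <= Num.sqrt a by rewrite -(ger0_norm z0) -sqrtr_sqr ler_wsqrtr.
suff : Num.sqrt (a - 2 * b) <= Num.sqrt a - z.
  have := sqrtr_ge0 (a - 2 * b); move: (Num.sqrt (a - 2 * b)) => v v0 vz.
  rewrite [leRHS]mulrC ler_wpM2r// ?lerXn2r ?nnegrE//; lra.
rewrite -[leRHS]ger0_norm ?subr_ge0// -sqrtr_sqr ler_wsqrtr//.
by rewrite sqrrB wa; lra.
Qed.

Lemma sqrt_diff_le a b z : 0 <= a -> 0 <= z -> 0 <= b ->
  b <= z * Num.sqrt a - z ^+ 2 / 2 ->
  4^-1 * (Num.sqrt a - Num.sqrt (a - 2 * b)) ^+ 2 <= z ^+ 2 / 4.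
Proof.
move=> a0 z0 b0 zb; have w0 := sqrtr_ge0 a.
have wa : Num.sqrt a ^+ 2 = a by rewrite sqr_sqrtr.
have : Num.sqrt (a - 2 * b) <= Num.sqrt a by rewrite ler_wsqrtr//; lra.
suff : Num.sqrt a - z <= Num.sqrt (a - 2 * b).
  move: (Num.sqrt (a - 2 * b)) => v vz va.
  rewrite mulrC ler_wpM2r ?lerXn2r ?nnegrE//; lra.
apply: le_trans (ler_norm _) _; rewrite -sqrtr_sqr ler_wsqrtr//.
by rewrite sqrrB wa; lra.
Qed.

End Rate.

(** * Tail bounds *)

Section Tails.
Variables (R : realType) (n : nat) (q : 'I_n -> 'I_n -> R).
Hypothesis q01 : forall i j : 'I_n, (i < j)%N -> 0 <= q i j <= 1.
Implicit Types (w : pred ('I_n * 'I_n)) (m t g : R).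

Lemma Prob_edge_count_up w m t : edge_mean q w <= m -> 0 < m -> 0 <= t <= 1 ->
  Prob q (fun A => (1 + t) * m <= edge_count w A) <= expR (- (t ^+ 2 * m / 9)).
Proof.
move=> wm m0 t01; apply: le_trans (Prob_edge_count_ge q01 wm m0 _) _.
  by case/andP: t01 => *; nra.
by rewrite ler_expR lerN2; exact: rate_ge_up.
Qed.

Lemma Prob_edge_count_lo w m t : m <= edge_mean q w -> 0 < m -> 0 <= t < 1 ->
  Prob q (fun A => edge_count w A <= (1 - t) * m) <= expR (- (t ^+ 2 * m / 9)).
Proof.
move=> wm m0 t01; apply: le_trans (Prob_edge_count_le q01 wm _ _) _.
- by case/andP: t01 => *; nra.
- by case/andP: t01 => *; nra.
by rewrite ler_expR lerN2; exact: rate_ge_lo.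
Qed.

(* [rate m] is not inverted: the event is contained in [y <= edge_count], where
   [y] is the least edge count it contains. *)
Lemma Prob_rate_ge w m g : edge_mean q w <= m -> 0 < m ->
  Prob q (fun A => (m <= edge_count w A) && (g <= rate m (edge_count w A))) <=
  expR (- g).
Proof.
move=> wm m0; set E := (X in Prob q X).
have [/existsP[A0 EA0]|/existsPn nE] := boolP [exists A, E A]; last first.
  by rewrite /Prob big1 ?expR_ge0// => A EA; have := nE A; rewrite EA.
case: (@arg_minP _ R (graph n) A0 E (edge_count w) EA0) => A1 /andP[mA gA] minA.
apply: (@le_trans _ _ (Prob q (fun A => edge_count w A1 <= edge_count w A))).
  by apply: (Prob_subset q01) => A _ /minA yA; exact: yA.
apply: le_trans (Prob_edge_count_ge q01 wm m0 mA) _.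
by rewrite ler_expR lerN2.
Qed.

End Tails.

(** * Union bound over vertex sets *)

Section Subsets.
Variable R : realType.

(** One term of the expansion of [(1 + x)^n]. At [x = d/n] it reads [C(n,d) <= (e n / d)^d]. *)
Lemma bin_mulX_le_expR (n d : nat) (x : R) : 0 <= x -> (d <= n)%N ->
  'C(n, d)%:R * x ^+ d <= expR (n%:R * x).
Proof.
move=> x0 dn; rewrite expRM_natl.
apply: (@le_trans _ _ ((1 + x) ^+ n)); last first.
  by rewrite lerXn2r ?nnegrE ?expR_ge0 ?expR_ge1Dx// addr_ge0.
rewrite exprDn (bigD1 (Ordinal (dn : d < n.+1)%N))//= expr1n mul1r mulr_natl.
by rewrite lerDl sumr_ge0// => i _; rewrite mulrn_wge0// mulr_ge0 ?exprn_ge0.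
Qed.

Lemma geometric_sum_le (x : R) k : 0 <= x <= 2^-1 ->
  \sum_(i < k) x ^+ i.+1 <= 2 * x.
Proof.
move=> /andP[x0 x1]; suff : \sum_(i < k) x ^+ i.+1 <= 2 * x - 2 * x ^+ k.+1.
  by have := exprn_ge0 k.+1 x0; lra.
elim: k => [|k IH]; first by rewrite big_ord0 expr1 subrr.
rewrite big_ord_recr/= [x ^+ k.+2]exprS.
by have := exprn_ge0 k.+1 x0; nra.
Qed.

(** There are at most [(e n / d)^d] sets of size [d]. The coefficient 1 in the exponent cancels
    [(n/d)^d], one [eta] absorbs [e^d] because [eta lam >= 1], and the other leaves a geometric
    series of ratio [exp (- eta lam) <= 1/2]. *)
Lemma sum_subsets_expR n (r : nat) (lam eta : R) : (0 < n)%N ->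
  (forall d, (0 < d <= r)%N -> lam <= ln (n%:R / d%:R)) ->
  0 <= eta -> 1 <= eta * lam ->
  \sum_(D : {set 'I_n} | (0 < #|D| <= r)%N)
     expR (- ((1 + 2 * eta) * (#|D|%:R * ln (n%:R / #|D|%:R)))) <=
  2 * expR (- (eta * lam)).
Proof.
move=> n0 hlam eta0 el1; set x := expR (- (eta * lam)).
have x01 : 0 <= x <= 2^-1.
  rewrite expR_ge0 /x expRN lef_pV2 ?posrE ?expR_gt0//.
  by apply: le_trans (expR_ge1Dx _); lra.
apply: le_trans (geometric_sum_le n x01).
have dlt (D : {set 'I_n}) : (#|D| < n.+1)%N by rewrite ltnS -[leqRHS]card_ord max_card.
rewrite (partition_big (fun D => Ordinal (dlt D)) (fun d : 'I_n.+1 => (0 < d)%N)); last first.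
  by move=> D /andP[].
rewrite big_mkcond big_ord_recl/= add0r; apply: ler_sum => i _.
set d := i.+1.
have dn : (d <= n)%N := ltn_ord i.
have [dr|rd] := leqP d r; last first.
  rewrite big1 ?exprn_ge0//; first by case/andP: x01.
  move=> D /andP[/andP[_ Dr]] /eqP/(congr1 val)/= Dd.
  by rewrite leqNgt Dd rd in Dr.
have d0 : 0 < d%:R :> R by rewrite ltr0n.
have n0' : 0 < n%:R :> R by rewrite ltr0n.
set f := expR (- ((1 + 2 * eta) * (d%:R * ln (n%:R / d%:R)))).
rewrite (eq_bigr (fun=> f)); last first.
  by move=> D /andP[_ /eqP/(congr1 val)/= ->].
rewrite sumr_const -[X in X <= _]mulr_natl.
apply: (@le_trans _ _ ('C(n, d)%:R * f)).
  rewrite ler_wpM2r ?expR_ge0// ler_nat -[n in 'C(n, _)]card_ord -card_draws.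
  apply: subset_leq_card; apply/fintype.subsetP => D.
  by rewrite !inE => /andP[_ /eqP/(congr1 val)/= ->].
have lnd : lam <= ln (n%:R / d%:R) by apply: hlam.
have -> : f = (d%:R / n%:R) ^+ d * expR (- (2 * eta * ln (n%:R / d%:R))) ^+ d.
  rewrite -exprMn -[d%:R / n%:R]invf_div -[_^-1]lnK; last first.
    by rewrite posrE invr_gt0 divr_gt0.
  by rewrite lnV ?posrE ?divr_gt0// -expRD -expRM_natl /f; congr expR; ring.
rewrite mulrA.
apply: (@le_trans _ _ (expR 1 ^+ d * (expR (-1) * x) ^+ d)); last first.
  by rewrite -exprMn mulrA -expRD subrr expR0 mul1r.
apply: ler_pM; rewrite ?mulr_ge0 ?exprn_ge0 ?divr_ge0 ?expR_ge0//.
  rewrite -expRM_natl mulr1; have := @bin_mulX_le_expR n d (d%:R / n%:R).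
  by rewrite [n%:R * _]mulrC divfK ?gt_eqF//; apply => //; rewrite divr_ge0 ?ltW.
rewrite lerXn2r ?nnegrE ?mulr_ge0 ?expR_ge0// -expRD ler_expR.
have : eta * lam <= eta * ln (n%:R / d%:R) by rewrite ler_wpM2l.
lra.
Qed.

End Subsets.

(** * The plug-in estimator *)

Section EhatBounds.
Variable R : realType.
Implicit Types a b s S t al be : R.

Definition ehat a b : R := 4^-1 * (Num.sqrt a - Num.sqrt (a - 2 * b)) ^+ 2.

Lemma sqrt2_sqr s t : 0 <= s -> 0 <= t ->
  exists2 z, 0 <= z & z ^+ 2 = 2 * (s * t) ^+ 2 :> R.
Proof.
move=> s0 t0; exists (Num.sqrt (2 * (s * t) ^+ 2)); first exact: sqrtr_ge0.
by rewrite sqr_sqrtr// mulr_ge0// sqr_ge0.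
Qed.

Lemma le_sqr (x y : R) : 0 <= y -> x ^+ 2 <= y ^+ 2 -> x <= y.
Proof.
move=> y0 xy; apply: le_trans (ler_norm x) _.
by rewrite -(ger0_norm y0) -!sqrtr_sqr ler_wsqrtr.
Qed.

(** At [a = S^2/2] and [b = s (S - s)] one has [a - 2 b = (S - 2 s)^2 / 2], so the difference of
    roots is [sqrt 2 * s]. The candidate [z] is this value shrunk by [t = 1 - 3 al], and
    [t^2 >= 1 - 6 al]. *)
Lemma ehat_ge a b s S al : 0 <= al <= 6^-1 -> 0 < s -> 4 * s <= S ->
  a <= (1 + al) * (S ^+ 2 / 2) -> (1 - al) * (s * (S - s)) <= b -> b <= a ->
  (1 - 6 * al) * (s ^+ 2 / 2) <= ehat a b.
Proof.
move=> /andP[al0 al1] s0 sS aS bs ba.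
pose t := 1 - 3 * al.
have t0 : 0 <= t by rewrite /t; lra.
have t1 : t <= 1 by rewrite /t; lra.
have [z z0 zz] := sqrt2_sqr (ltW s0) t0.
(* No lower bound on [a] is given; [b <= a] transfers this one, which yields [z ^+ 2 <= a]. *)
have b2 : 2 * s ^+ 2 <= b.
  apply: le_trans bs.
  have -> : (1 - al) * (s * (S - s)) = s * ((1 - al) * (S - s)) by ring.
  have -> : 2 * s ^+ 2 = s * (2 * s) by ring.
  rewrite ler_pM2l//.
  have : 5 / 6 * (S - s) <= (1 - al) * (S - s) by rewrite ler_wpM2r; lra.
  lra.
have st : (s * t) ^+ 2 <= s ^+ 2.
  by rewrite lerXn2r ?nnegrE ?mulr_ge0 ?(ltW s0)// ler_piMr// ltW.
have a0 : 0 <= a by apply: le_trans ba; apply: le_trans b2; rewrite mulr_ge0// sqr_ge0.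
apply: (@le_trans _ _ (z ^+ 2 / 4)).
  rewrite zz exprMn.
  have -> : (1 - 6 * al) * (s ^+ 2 / 2) = s ^+ 2 * ((1 - 6 * al) / 2) by ring.
  have -> : 2 * (s ^+ 2 * t ^+ 2) / 4 = s ^+ 2 * (t ^+ 2 / 2) by field.
  rewrite ler_wpM2l ?sqr_ge0//.
  by have := sqr_ge0 al; rewrite /t sqrrB; lra.
apply: sqrt_diff_ge => //; first by rewrite zz; lra.
pose X := s * t * S * (1 + al / 2).
have X0 : 0 <= X by rewrite !mulr_ge0//; lra.
have zX : z * Num.sqrt a <= X.
  apply: le_sqr X0 _; rewrite exprMn sqr_sqrtr// zz /X.
  apply: (@le_trans _ _ (2 * (s * t) ^+ 2 * ((1 + al) * (S ^+ 2 / 2)))).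
    by rewrite ler_wpM2l// mulr_ge0// sqr_ge0.
  have -> : 2 * (s * t) ^+ 2 * ((1 + al) * (S ^+ 2 / 2)) =
            (s * t * S) ^+ 2 * (1 + al) by field.
  rewrite [leRHS]exprMn ler_wpM2l ?sqr_ge0//.
  by have := sqr_ge0 al; nra.
apply: (le_trans _ bs); apply: (le_trans (lerB zX (lexx _))).
rewrite zz /X.
have -> : s * t * S * (1 + al / 2) - 2 * (s * t) ^+ 2 / 2 =
  s * (t * S * (1 + al / 2) - t ^+ 2 * s) by field.
rewrite mulrCA ler_pM2l// /t.
have H : al * (4 * s) <= al * S by rewrite ler_wpM2l.
have H2 : al ^+ 2 * (4 * s) <= al ^+ 2 * S by rewrite ler_wpM2l ?sqr_ge0.
have H3 : 0 <= al ^+ 2 * S by rewrite mulr_ge0 ?sqr_ge0//; lra.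
have H4 : 0 <= al ^+ 2 * s by rewrite mulr_ge0 ?sqr_ge0//; lra.
have H5 : 0 <= al * S by rewrite mulr_ge0//; lra.
have -> : (1 - 3 * al) * S * (1 + al / 2) =
   S - 5 / 2 * (al * S) - 3 / 2 * (al ^+ 2 * S) by field.
have -> : (1 - 3 * al) ^+ 2 * s = s - 6 * (al * s) + 9 * (al ^+ 2 * s) by ring.
have -> : (1 - al) * (S - s) = S - s - al * S + al * s by ring.
lra.
Qed.

(** The same candidate enlarged by [t = 1 + 2 (al + be)]. The error [be] of the cross count is kept
    apart from [al] because it also carries the edges added by the community. *)
Lemma ehat_le a b s S al be : 0 <= al <= 4^-1 -> 0 <= be -> al + be <= 2^-1 ->
  0 < s -> 12 * s <= S ->
  (1 - al) * (S ^+ 2 / 2) <= a -> 0 <= b -> b <= (1 + be) * (s * (S - s)) ->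
  ehat a b <= (1 + 6 * (al + be)) * (s ^+ 2 / 2).
Proof.
move=> /andP[al0 al1] be0 ga1 s0 sS aS b0 bs.
pose g := al + be; pose t := 1 + 2 * g.
have g0 : 0 <= g by rewrite /g; lra.
have g1 : g <= 2^-1 by [].
have t0 : 0 <= t by rewrite /t; lra.
have [z z0 zz] := sqrt2_sqr (ltW s0) t0.
have a0 : 0 <= a by apply: le_trans aS; rewrite mulr_ge0 ?divr_ge0 ?sqr_ge0//; lra.
apply: (@le_trans _ _ (z ^+ 2 / 4)); last first.
  rewrite zz exprMn -/g.
  have -> : 2 * (s ^+ 2 * t ^+ 2) / 4 = t ^+ 2 * (s ^+ 2 / 2) by field.
  by rewrite ler_wpM2r ?divr_ge0 ?sqr_ge0// /t; nra.
apply: sqrt_diff_le => //.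
have zX : s * t * S * (1 - al) <= z * Num.sqrt a.
  apply: le_sqr; first by rewrite mulr_ge0// sqrtr_ge0.
  rewrite [leRHS]exprMn sqr_sqrtr// zz.
  apply: (@le_trans _ _ (2 * (s * t) ^+ 2 * ((1 - al) * (S ^+ 2 / 2)))); last first.
    by rewrite ler_wpM2l// mulr_ge0// sqr_ge0.
  have -> : 2 * (s * t) ^+ 2 * ((1 - al) * (S ^+ 2 / 2)) =
            (s * t * S) ^+ 2 * (1 - al) by field.
  by rewrite [leLHS]exprMn ler_wpM2l ?sqr_ge0//; nra.
apply: (le_trans bs); apply: (le_trans _ (lerB zX (lexx _))).
rewrite zz.
have -> : s * t * S * (1 - al) - 2 * (s * t) ^+ 2 / 2 =
  s * (t * S * (1 - al) - t ^+ 2 * s) by field.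
rewrite mulrCA ler_pM2l//.
have S0 : 0 <= S by lra.
have H1 : g * (12 * s) <= g * S by rewrite ler_wpM2l.
have H2 : (g * al) * S <= g * S / 4.
  by rewrite -mulrA [al * S]mulrC mulrA ler_wpM2l ?mulr_ge0.
have H3 : g ^+ 2 * s <= g * s / 2.
  have : g * g * s <= g * 2^-1 * s by rewrite ler_wpM2r ?(ltW s0)// ler_wpM2l.
  by rewrite expr2; lra.
have H4 : 0 <= be * s by rewrite mulr_ge0// ltW.
have -> : t * S * (1 - al) = S + 2 * (g * S) - al * S - 2 * (g * al * S) by rewrite /t; ring.
have -> : t ^+ 2 * s = s + 4 * (g * s) + 4 * (g ^+ 2 * s) by rewrite /t; ring.
have -> : (1 + be) * (S - s) = S - s + be * S - be * s by ring.
have -> : be * S = g * S - al * S by rewrite /g; ring.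
lra.
Qed.

End EhatBounds.

(** * Stability of the rate *)

Section Perturbation.
Variable R : realType.
Implicit Types c d e g h k m p t x y mu L M eta zeta rho lam : R.

(* [ln y = 2 ln (sqrt y) <= 2 sqrt y]. *)
Lemma ln_le_mul c y : 0 < c -> 0 < y -> 4 <= c ^+ 2 * y -> ln y <= c * y.
Proof.
move=> c0 y0 H; have w0 : 0 < Num.sqrt y by rewrite sqrtr_gt0.
have wy : Num.sqrt y ^+ 2 = y by rewrite sqr_sqrtr// ltW.
have -> : ln y = 2 * ln (Num.sqrt y) by rewrite -{1}wy lnXn// mulr_natl.
have H1 := ln_le_subr1 w0.
have H2 : 2 <= c * Num.sqrt y.
  apply: le_sqr; first by rewrite mulr_ge0 ?ltW.
  by rewrite exprMn wy; lra.
have : 2 * Num.sqrt y <= c * y.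
  by rewrite -{2}wy expr2 mulrA ler_pM2r.
lra.
Qed.

(** Meant for [y = eta (e - mu)] and [g = L]: writing [e = mu + (e - mu)] in
    [(e - mu)^2 <= 4 e (rate mu e)] brings [y] back on the right. If [y > t g], the hypotheses force
    [y^2 < y^2]. *)
Lemma quad_le y t g k : 0 < t -> 0 <= g -> 0 <= y ->
  4 * k * (1 + t) <= t ^+ 2 -> y ^+ 2 <= 4 * k * g ^+ 2 + 4 * k * g * y ->
  y <= t * g.
Proof.
move=> t0 g0 y0 kt Hy; rewrite leNgt; apply/negP => ty.
have [k0|k0] := ltP k 0.
  have : y ^+ 2 <= 0.
    apply: le_trans Hy _.
    have -> : 4 * k * g ^+ 2 + 4 * k * g * y = - (4 * (- k) * (g ^+ 2 + g * y)) by ring.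
    by rewrite oppr_le0 !mulr_ge0 ?addr_ge0 ?mulr_ge0 ?sqr_ge0//; lra.
  have : 0 < y by apply: le_lt_trans ty; rewrite mulr_ge0// ltW.
  by nra.
have y1 : 0 < y by apply: le_lt_trans ty; rewrite mulr_ge0// ltW.
have H1 : t * (g * y) < y ^+ 2 by rewrite mulrA expr2 ltr_pM2r.
have H2 : t ^+ 2 * g ^+ 2 <= t * (g * y).
  have -> : t ^+ 2 * g ^+ 2 = t * (g * (t * g)) by ring.
  by rewrite (ler_wpM2l (ltW t0))// ler_wpM2l// ltW.
have H3 : t ^+ 2 * y ^+ 2 <= 4 * k * (t ^+ 2 * g ^+ 2) + 4 * k * t * (t * (g * y)).
  have -> : 4 * k * (t ^+ 2 * g ^+ 2) + 4 * k * t * (t * (g * y)) =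
     t ^+ 2 * (4 * k * g ^+ 2 + 4 * k * g * y) by ring.
  by rewrite ler_wpM2l ?sqr_ge0.
have H4 : 4 * k * (1 + t) * y ^+ 2 <= t ^+ 2 * y ^+ 2 by rewrite ler_wpM2r ?sqr_ge0.
have H5 : 4 * k * (t * (g * y)) <= 4 * k * y ^+ 2.
  by rewrite ler_wpM2l ?mulr_ge0// ltW.
have H6 : 4 * k * (t ^+ 2 * g ^+ 2) <= 4 * k * (t * (g * y)).
  by rewrite ler_wpM2l ?mulr_ge0.
have H7 : 4 * k * t * (t * (g * y)) <= 4 * k * t * y ^+ 2.
  by rewrite ler_wpM2l ?mulr_ge0// ltW.
have [kz|k1] := eqVneq k 0.
  have : 0 < t ^+ 2 * y ^+ 2 by rewrite mulr_gt0 ?exprn_gt0.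
  by move: H3; rewrite kz; lra.
have k2 : 0 < k by rewrite lt_neqAle eq_sym k1.
have : 4 * k * (t * (g * y)) < 4 * k * y ^+ 2 by rewrite ltr_pM2l ?mulr_gt0.
lra.
Qed.

(** Budget in units of [eps L]: 1/6 from the deviation bound, and 1/24 for each of the two terms of
    [rate_perturb], in total 1/4 < 1/3. *)
Lemma rate_perturb_lt eps k mu L m e eta :
  0 < eps -> k <= eps / 48 ->
  4 * (k * (1 + eps / 6)) * (1 + eps / 48) <= (eps / 48) ^+ 2 ->
  0 < mu -> 0 < L -> 0 <= eta <= 2^-1 -> eta <= k -> eta ^+ 2 * mu <= k * L ->
  (1 - eta) * mu <= m -> m <= e ->
  (mu <= e -> rate mu e <= (1 + eps / 6) * L) ->
  rate m e < (1 + eps / 3) * L.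
Proof.
move=> eps0 k1 k2 mu0 L0 eta01 etak etaL xm me Hr.
have eta0 : 0 <= eta by case/andP: eta01.
apply: le_lt_trans (rate_perturb mu0 eta01 xm me) _.
have kL : k * L <= eps / 48 * L by rewrite ler_wpM2r// ltW.
have epsL : 0 < eps * L by rewrite mulr_gt0.
case: ifP => mue; last by lra.
have {}Hr := Hr mue.
suff : eta * (e - mu) <= eps / 48 * L by lra.
have e0 : 0 < e by apply: lt_le_trans mue.
have r0 := rate_ge0 mu0 e0.
apply: (quad_le (k := k * (1 + eps / 6))) => //; [lra|exact: ltW| |].
  by rewrite mulr_ge0// subr_ge0.
rewrite exprMn; have H := sqr_sub_le_rate mu0 mue.
apply: (@le_trans _ _ (eta ^+ 2 * (4 * e * ((1 + eps / 6) * L)))).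
  rewrite ler_wpM2l ?sqr_ge0//; apply: le_trans H _.
  by rewrite ler_wpM2l ?mulr_ge0// ltW.
have -> : eta ^+ 2 * (4 * e * ((1 + eps / 6) * L)) =
   4 * (1 + eps / 6) * L * (eta ^+ 2 * mu) +
   4 * (1 + eps / 6) * L * (eta * (eta * (e - mu))) by ring.
have c0 : 0 <= 4 * (1 + eps / 6) * L by rewrite !mulr_ge0// ?ltW//; lra.
have H1 := ler_wpM2l c0 etaL.
have H2 : eta * (eta * (e - mu)) <= k * (eta * (e - mu)).
  by rewrite ler_wpM2r// mulr_ge0// subr_ge0.
have {}H2 := ler_wpM2l c0 H2.
lra.
Qed.

Lemma sqr_mul_ln_le rho : 1 <= rho ->
  (rho * ln rho) ^+ 2 <= 2 * hfun (rho - 1) ^+ 2 + 8 * (rho * hfun (rho - 1)).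
Proof.
move=> r1; have := sqr_sub1_le_hfun r1.
have -> : rho * ln rho = hfun (rho - 1) + (rho - 1) by rewrite hfun_subr1; ring.
move: (hfun _) => h H; have := sqr_ge0 (h - (rho - 1)).
rewrite sqrrB sqrrD => ?; lra.
Qed.

(** [x] is the fluctuation of [e(D)] below [rho mu], and [x ln rho] its price in the dual bound. By
    [sqr_mul_ln_le] the squared price has a part in [g^2] and a part in [p g], hence the demand that
    both [p] and [g] exceed [K]; 90 is 9 times 2 + 8. *)
Lemma dev_ln_le c K M mu rho x : 1 < rho -> 0 < mu -> 0 <= x -> 0 <= M -> 0 < c ->
  0 < K -> x ^+ 2 = 9 * M * (rho * mu) -> K <= rho * mu ->
  K <= mu * hfun (rho - 1) -> 90 * M <= c ^+ 2 * K ->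
  x * ln rho <= c * (mu * hfun (rho - 1)).
Proof.
move=> r1 mu0 x0 M0 c0 K0 xE; set p := rho * mu; set g := mu * hfun _.
move=> Kp Kg MK; have p0 : 0 < p by rewrite mulr_gt0//; lra.
have g0 : 0 < g by apply: lt_le_trans Kg.
apply: le_sqr; first by rewrite mulr_ge0 ?ltW.
rewrite -(ler_pM2r p0).
have -> : (x * ln rho) ^+ 2 * p = 9 * M * (mu ^+ 2 * (rho * ln rho) ^+ 2).
  by rewrite exprMn xE /p; ring.
apply: (@le_trans _ _ (9 * M * (2 * g ^+ 2 + 8 * (p * g)))).
  rewrite ler_wpM2l ?mulr_ge0//.
  have -> : 2 * g ^+ 2 + 8 * (p * g) =
     mu ^+ 2 * (2 * hfun (rho - 1) ^+ 2 + 8 * (rho * hfun (rho - 1))).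
    by rewrite /g /p; ring.
  by rewrite ler_wpM2l ?sqr_ge0// sqr_mul_ln_le// ltW.
have H1 : 90 * M * g ^+ 2 <= c ^+ 2 * p * g ^+ 2.
  rewrite ler_wpM2r ?sqr_ge0//; apply: le_trans MK _.
  by rewrite ler_wpM2l ?sqr_ge0.
have H2 : 90 * M * (p * g) <= c ^+ 2 * g * (p * g).
  rewrite ler_wpM2r ?(ltW (mulr_gt0 p0 g0))//; apply: le_trans MK _.
  by rewrite ler_wpM2l ?sqr_ge0.
have -> : (c * g) ^+ 2 * p = c ^+ 2 * p * g ^+ 2 by ring.
lra.
Qed.

(** Two smallness conditions for two ranges: [zeta^2 <= k h], drawn from the bound on [zeta^2 mu],
    serves [rho] near 1, where [h] is quadratic in [rho - 1]; [zeta^2 <= k] serves large [rho]. The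
    bound [(rho - 1)^2 <= 4 rho h] joins them. *)
Lemma perturb_hfun_le k t mu L zeta rho : 1 < rho -> 0 < mu -> 0 < t ->
  0 <= zeta -> zeta ^+ 2 <= k -> 64 * k <= t ^+ 2 -> zeta ^+ 2 * mu <= k * L ->
  L <= mu * hfun (rho - 1) ->
  zeta * (rho - 1) <= t * hfun (rho - 1).
Proof.
move=> r1 mu0 t0 z0 zk kt zmu; set h := hfun _ => Lh.
have h0 : 0 <= h by rewrite hfun_ge0// ltW.
have k0 : 0 <= k by apply: le_trans zk; rewrite sqr_ge0.
have zh : zeta ^+ 2 <= k * h.
  rewrite -(ler_pM2r mu0); apply: le_trans zmu _.
  by rewrite -mulrA [h * _]mulrC ler_wpM2l.
have zt : 8 * zeta <= t by apply: le_sqr; [exact: ltW|rewrite exprMn; lra].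
have y0 : 0 <= zeta * (rho - 1) by rewrite mulr_ge0// subr_ge0 ltW.
have H := sqr_sub1_le_hfun (ltW r1); rewrite -/h in H.
have {}H : (zeta * (rho - 1)) ^+ 2 <= zeta ^+ 2 * (4 * rho * h).
  by rewrite exprMn ler_wpM2l ?sqr_ge0.
set y := zeta * (rho - 1) in y0 H *.
have E : zeta ^+ 2 * (4 * rho * h) = 4 * h * zeta ^+ 2 + 4 * zeta * (h * y).
  by rewrite /y; ring.
rewrite {}E in H.
have H1 : h * zeta ^+ 2 <= h * (k * h) by rewrite ler_wpM2l.
have H2 : 8 * zeta * (h * y) <= t * (h * y) by rewrite ler_wpM2r// mulr_ge0.
rewrite leNgt; apply/negP => ty.
have yp : 0 < y by apply: le_lt_trans ty; rewrite mulr_ge0// ltW.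
have H3 : t * h * y < y * y by rewrite ltr_pM2r.
have H4 : 64 * k * h ^+ 2 <= t ^+ 2 * h ^+ 2 by rewrite ler_wpM2r ?sqr_ge0.
have H5 : (t * h) ^+ 2 <= y ^+ 2.
  by rewrite lerXn2r ?nnegrE ?(ltW yp) ?(ltW ty)// (mulr_ge0 (ltW t0)).
clearbody y; nra.
Qed.

Lemma sqr_zeta_le x y z q :
  (12 * (x + y + z) + 2 * q) ^+ 2 <= 576 * (x ^+ 2 + y ^+ 2 + z ^+ 2 + q ^+ 2).
Proof.
have := sqr_ge0 (12 * x - 12 * y); have := sqr_ge0 (12 * x - 12 * z).
have := sqr_ge0 (12 * x - 2 * q); have := sqr_ge0 (12 * z - 12 * y).
have := sqr_ge0 (12 * y - 2 * q); have := sqr_ge0 (12 * z - 2 * q).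
have := sqr_ge0 q; lra.
Qed.

(** Passes from [s^2/2] to [mu]: [x] is [s^2], [y] the sum of squared weights, and [q = u/s], so the
    diagonal costs a relative error of order [q]. *)
Lemma ehat_mean_le x y mu g q : 0 <= q <= 2^-1 -> 0 <= x -> y <= q * x ->
  x = 2 * mu + y -> 0 <= g -> 0 <= mu ->
  (1 + 6 * g) * (x / 2) <= (1 + (12 * g + 2 * q)) * mu.
Proof.
move=> /andP[q0 q1] x0 yx xE g0 mu0.
have H : x / 2 <= (1 + 2 * q) * mu.
  have -> : mu = (x - y) / 2 by lra.
  have : 0 <= q * (1 - 2 * q) * x by rewrite mulr_ge0// mulr_ge0//; lra.
  have : (1 + 2 * q) * y <= (1 + 2 * q) * (q * x) by rewrite ler_wpM2l//; lra.
  lra.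
apply: (@le_trans _ _ ((1 + 6 * g) * ((1 + 2 * q) * mu))).
  by rewrite ler_wpM2l//; lra.
rewrite mulrA ler_wpM2r//.
have : g * q <= g * 2^-1 by rewrite ler_wpM2l.
lra.
Qed.

(** [c] solves [(1 - 2 c)(1 + eps) = 1 + eps/2]: one share [c] of [mu h] pays for the fluctuation of
    [e(D)], the other for the error of the estimator. *)
Lemma alt_small c mu rho L E e x eta eps : 0 < eps -> 4 * c * (1 + eps) = eps ->
  1 < rho -> 0 < mu -> 0 < L -> 0 < E -> 0 <= e -> rho * mu - x <= e ->
  (1 + eps) * L <= mu * hfun (rho - 1) ->
  x * ln rho <= c * (mu * hfun (rho - 1)) ->
  eta * (rho - 1) <= c * hfun (rho - 1) -> E <= (1 + eta) * mu ->
  (1 + eps / 3) * L <= E * hfun (Num.max (e / E - 1) 0).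
Proof.
move=> eps0 ceps r1 mu0 L0 E0 e0 ex muh xc etac Emu.
apply: le_trans (mul_hfun_ge_dual E0 e0 (ltW r1)).
have l0 : 0 <= ln rho by rewrite ln_ge0// ltW.
have H1 : (rho * mu - x) * ln rho <= e * ln rho by rewrite ler_wpM2r.
have H2 : E * (rho - 1) <= (1 + eta) * mu * (rho - 1).
  by rewrite ler_wpM2r// subr_ge0 ltW.
have H3 : mu * (eta * (rho - 1)) <= mu * (c * hfun (rho - 1)).
  by rewrite ler_wpM2l// ltW.
have muhE : mu * hfun (rho - 1) = rho * mu * ln rho - mu * (rho - 1).
  by rewrite hfun_subr1; ring.
have H4 : (1 - 2 * c) * ((1 + eps) * L) <= (1 - 2 * c) * (mu * hfun (rho - 1)).
  rewrite ler_wpM2l//; nra.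
have H5 : (1 - 2 * c) * ((1 + eps) * L) = (1 + eps / 2) * L.
  have -> : (1 - 2 * c) * ((1 + eps) * L) = (1 + eps - (4 * c * (1 + eps)) / 2) * L by field.
  by rewrite ceps; field.
have : (1 + eps / 3) * L <= (1 + eps / 2) * L by rewrite ler_wpM2r ?ltW//; lra.
lra.
Qed.

(** [B] is the second term of [Etilde] and [v = n/|D|]. Of the main term [rho mu ln rho], a share
    [c/2] goes to the fluctuation [a], [c/2] to replacing [ln rho] by [ln (rho mu / B)], and [c/2]
    to the subtracted [rho mu]; the available share is [2 c]. *)
Lemma alt_large c mu rho L B e a eps v lam :
  0 < eps -> 4 * c * (1 + eps) = eps ->
  1 < rho -> 0 < mu -> 0 < L -> 0 < v -> 1 <= lam -> lam <= ln v ->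
  B * v = L * ln v ^+ 3 -> mu < B -> B <= ln v ^+ 4 * mu ->
  0 <= a -> 2 * a <= c -> 4 <= c * lam -> 1024 <= c ^+ 2 * lam ->
  (1 - a) * (rho * mu) <= e ->
  (1 + eps) * L <= mu * hfun (rho - 1) ->
  (1 + eps / 3) * L <= B * hfun (Num.max (e / B - 1) 0).
Proof.
move=> eps0 ceps r1 mu0 L0 v0 lam1 lamv BvE muB Bmu a0 a1 c1 c2 ea muh.
have c0 : 0 < c by nra.
have c4 : c < 4^-1 by nra.
set g := ln v in lamv BvE Bmu *.
have g1 : 1 <= g by lra.
have gp : 0 < g by lra.
have B0 : 0 < B by apply: lt_trans muB.
have h0 : 0 <= hfun (rho - 1) by rewrite hfun_ge0// ltW.
have r0 : 0 < rho by lra.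
have hh := hfun_le_mul_ln (ltW r1).
(* Compare [L <= mu h <= B rho ln rho] with [B v = L g^3]. *)
have rl : v / g ^+ 3 <= rho * ln rho.
  rewrite ler_pdivrMr ?exprn_gt0// -(ler_pM2l B0) BvE.
  have -> : B * (rho * ln rho * g ^+ 3) = B * (rho * ln rho) * g ^+ 3 by ring.
  rewrite ler_wpM2r ?exprn_ge0 ?(ltW gp)//.
  have : mu * hfun (rho - 1) <= B * (rho * ln rho).
    by apply: ler_pM => //; rewrite ltW.
  have : L <= (1 + eps) * L by rewrite ler_peMl ?ltW//; lra.
  lra.
have lnr0 : 0 < ln rho by rewrite ln_gt0.
have rv : v / g ^+ 4 <= rho.
  rewrite leNgt; apply/negP => rv.
  have : rho * ln rho < v / g ^+ 3; last by rewrite ltNge rl.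
  have lr : ln rho <= g.
    rewrite /g ler_ln ?posrE//; apply: le_trans (ltW rv) _.
    by rewrite ler_piMr ?(ltW v0)// invf_le1 ?exprn_gt0// exprn_ege1.
  apply: (@le_lt_trans _ _ (rho * g)); first by rewrite ler_pM2l.
  by move: rv; rewrite ltr_pdivlMr ?exprn_gt0// ltr_pdivlMr ?exprn_gt0// -mulrA -exprS.
have llg : 16 * ln g <= c * g.
  have := @ln_le_mul (c / 16) g; rewrite divr_gt0// gp.
  have -> : 4 <= (c / 16) ^+ 2 * g.
    have : c ^+ 2 * lam <= c ^+ 2 * g by rewrite ler_wpM2l ?sqr_ge0.
    have -> : (c / 16) ^+ 2 * g = c ^+ 2 * g / 256 by field.
    lra.
  by move=> /(_ isT isT isT); lra.
have lr : g - 4 * ln g <= ln rho.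
  move: rv; rewrite -ler_ln ?posrE ?divr_gt0 ?exprn_gt0//.
  by rewrite ln_div_split ?exprn_gt0// lnXn// mulr_natl.
have cg : c * g <= g / 4 by rewrite mulrC ler_wpM2l ?ltW.
have gr : g <= 2 * ln rho by lra.
pose l := rho * mu / B.
have l0 : 0 < l by rewrite divr_gt0// mulr_gt0.
have lnl : (1 - c / 2) * ln rho <= ln l.
  rewrite /l ln_div_split ?mulr_gt0// lnM ?posrE//.
  have : ln B <= 4 * ln g + ln mu.
    rewrite (_ : 4 * ln g = ln (g ^+ 4)); last by rewrite lnXn// mulr_natl.
    by rewrite -lnM ?posrE ?exprn_gt0// ler_ln ?posrE// mulr_gt0// exprn_gt0.
  have : c * g <= c * (2 * ln rho) by rewrite ler_wpM2l// ltW.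
  by clear -llg; lra.
have lnl0 : 0 <= ln l by apply: le_trans lnl; rewrite mulr_ge0// ?(ltW lnr0)//; clear -c4; lra.
have l1 : 1 <= l by rewrite -ler_ln ?posrE// ln1.
have pm0 : 0 < rho * mu by rewrite mulr_gt0.
have e0 : 0 <= e by apply: le_trans ea; rewrite mulr_ge0 ?(ltW pm0)//; clear -a1 c4; lra.
apply: le_trans (mul_hfun_ge_dual B0 e0 l1).
have H1 : (1 - a) * (rho * mu) * ln l <= e * ln l by rewrite ler_wpM2r.
have H2 : B * l = rho * mu by rewrite /l mulrC divfK// gt_eqF.
have H3 : (1 - a) * (rho * mu) * ((1 - c / 2) * ln rho) <= (1 - a) * (rho * mu) * ln l.
  by rewrite ler_wpM2l// mulr_ge0 ?(ltW pm0)//; clear -a1 c4; lra.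
have H4 : 2 <= c * ln rho.
  have : c * lam <= c * g by rewrite ler_wpM2l// ltW.
  have : c * g <= c * (2 * ln rho) by rewrite ler_wpM2l// ltW.
  by clear -c1; lra.
have H5 : 2 * (rho * mu) <= c * ln rho * (rho * mu) by rewrite ler_pM2r.
pose Y := rho * mu * ln rho.
have Y0 : 0 < Y by rewrite mulr_gt0.
have H6 : (1 - 3 / 2 * c) * Y <= (1 - a) * (rho * mu) * ((1 - c / 2) * ln rho) - rho * mu.
  have -> : (1 - a) * (rho * mu) * ((1 - c / 2) * ln rho) =
     (1 - a - c / 2 + a * c / 2) * Y by rewrite /Y; field.
  have H7 : (1 - a - c / 2) * Y <= (1 - a - c / 2 + a * c / 2) * Y.
    by rewrite ler_wpM2r ?(ltW Y0)// lerDl !mulr_ge0// ltW.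
  have H8 : a * Y <= c / 2 * Y by rewrite ler_wpM2r ?(ltW Y0)//; clear -a1; lra.
  have -> : rho * mu = Y - (Y - rho * mu) by ring.
  have : c * ln rho * (rho * mu) = c * Y by rewrite /Y; ring.
  by clear -H5 H7 H8; lra.
have H7 : (1 + eps) * L <= Y.
  apply: le_trans muh _; apply: (@le_trans _ _ (mu * (rho * ln rho))).
    by rewrite ler_wpM2l// ltW.
  by rewrite /Y mulrCA mulrA.
have H8 : (1 - 2 * c) * ((1 + eps) * L) <= (1 - 3 / 2 * c) * Y.
  apply: (@le_trans _ _ ((1 - 2 * c) * Y)); first by rewrite ler_wpM2l//; clear -c4; lra.
  by rewrite ler_wpM2r ?(ltW Y0)//; clear -c0; lra.
have H9 : (1 - 2 * c) * ((1 + eps) * L) = (1 + eps / 2) * L.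
  have -> : (1 - 2 * c) * ((1 + eps) * L) = (1 + eps - (4 * c * (1 + eps)) / 2) * L by field.
  by rewrite ceps; field.
have H10 : (1 + eps / 3) * L <= (1 + eps / 2) * L by rewrite ler_wpM2r ?(ltW L0)//; clear -eps0; lra.
have H11 : B * (l - 1) <= rho * mu by rewrite mulrBr H2 mulr1; clear -B0; lra.
by clear -H1 H3 H6 H8 H9 H10 H11; lra.
Qed.

End Perturbation.

(** * The rank-1 regime *)

Section Regime.
Variables (R : realType) (n : nat) (theta : 'I_n -> R) (r : nat) (delta l u : R).
Hypotheses (n0 : (0 < n)%N) (l0 : 0 < l).
Hypotheses (thl : forall i, l <= theta i) (thu : forall i, theta i <= u).
Hypotheses (u1 : u <= 1) (delta0 : 0 < delta) (delta1 : delta <= 100^-1).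
Hypothesis kappa_r : (u / l) ^+ 2 <= delta * (r%:R : R) `^ (2 / 3).
Hypothesis kappa_n : (u / l) ^+ 2 <= delta * (n%:R / r%:R * l ^+ 2).
Hypothesis r_n : r%:R <= delta * n%:R.
Implicit Types (D C : {set 'I_n}) (A : graph n).

(* [lra] is slow in large contexts and fails once a section variable is cleared. *)
Tactic Notation "keep" hyp_list(hs) :=
  clear - hs n0 l0 thl thu u1 delta0 delta1 kappa_r kappa_n r_n.

Definition wt D : R := \sum_(i in D) theta i.
Definition mu0 D : R := edge_mean (p0 theta) (inside D).
Definition cost D : R := #|D|%:R * ln (n%:R / #|D|%:R).
Definition floor_term D : R := #|D|%:R ^+ 2 / n%:R * ln (n%:R / #|D|%:R) ^+ 4.
Local Notation S := (wt finset.setT).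
Local Notation lam := (ln delta^-1).

Lemma nR_gt0 : 0 < n%:R :> R. Proof. by rewrite ltr0n. Qed.

Lemma lu : l <= u.
Proof. exact: le_trans (thl (Ordinal n0)) (thu _). Qed.

Lemma u_gt0 : 0 < u. Proof. exact: lt_le_trans lu. Qed.

Lemma kappa_ge1 : 1 <= (u / l) ^+ 2.
Proof. by rewrite exprn_ege1// ler_pdivlMr// mul1r lu. Qed.

Lemma r_gt0 : (0 < r)%N.
Proof.
rewrite lt0n; apply/eqP => rz; have := le_trans kappa_ge1 kappa_r.
by rewrite rz powR0 ?mulr0 ?ler10// mulf_neq0// invr_neq0.
Qed.

Lemma rR_gt0 : 0 < r%:R :> R. Proof. by rewrite ltr0n r_gt0. Qed.

Lemma r_usqr : r%:R * u ^+ 2 <= delta * n%:R * l ^+ 4.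
Proof.
have := kappa_n; rewrite expr_div_n ler_pdivrMr ?exprn_gt0//.
rewrite -(ler_pM2l rR_gt0) => /le_trans; apply.
apply: le_of_eq; field.
by rewrite gt_eqF// rR_gt0.
Qed.

Lemma r_u : r%:R * u <= delta * l ^+ 2 * (n%:R * l).
Proof.
rewrite -(ler_pM2r l0); apply: (@le_trans _ _ (r%:R * u ^+ 2)).
  by rewrite -mulrA expr2 ler_pM2l ?rR_gt0// ler_pM2l ?u_gt0// lu.
by apply: le_trans r_usqr _; apply: le_of_eq; ring.
Qed.

(** Since [r >= 1], the second half of [assumption3] alone makes [n theta_min^2] large. *)
Lemma delta_nl : 1 <= delta * (n%:R * l ^+ 2).
Proof.
have lr : l * r%:R <= r%:R * u by rewrite mulrC ler_pM2l ?rR_gt0// lu.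
have : l * r%:R <= l * (delta * (n%:R * l ^+ 2)).
  by apply: le_trans lr _; apply: le_trans r_u _; apply: le_of_eq; ring.
rewrite ler_pM2l//; apply: le_trans; by rewrite ler1n r_gt0.
Qed.

Lemma wt_ge D : #|D|%:R * l <= wt D.
Proof. by rewrite mulr_natl -sumr_const; apply: ler_sum. Qed.

Lemma wt_le D : wt D <= #|D|%:R * u.
Proof. by rewrite mulr_natl -sumr_const; apply: ler_sum. Qed.

Lemma S_ge : n%:R * l <= S.
Proof. by have := wt_ge finset.setT; rewrite cardsT card_ord. Qed.

Lemma S_gt0 : 0 < S.
Proof. by apply: lt_le_trans S_ge; rewrite mulr_gt0// nR_gt0. Qed.

Lemma wt_gt0 D : (0 < #|D|)%N -> 0 < wt D.
Proof. by move=> D0; apply: lt_le_trans (wt_ge D); rewrite mulr_gt0// ltr0n. Qed.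

Lemma wt_ge0 D : 0 <= wt D.
Proof. by apply: le_trans (wt_ge D); rewrite mulr_ge0// ltW. Qed.

(** The factor [l ^+ 2] is kept because [rho] can be as large as [1 / l^2]; the two cancel when the
    edges added by the community are counted. *)
Lemma wt_small D : (#|D| <= r)%N -> wt D <= delta * l ^+ 2 * S.
Proof.
move=> Dr; apply: le_trans (wt_le D) _; apply: (@le_trans _ _ (r%:R * u)).
  by rewrite ler_pM2r ?u_gt0// ler_nat.
by apply: le_trans r_u _; rewrite ler_wpM2l ?S_ge// mulr_ge0 ?sqr_ge0// ltW.
Qed.

Lemma l_le1 : l <= 1. Proof. exact: le_trans lu u1. Qed.

Lemma wt_le_deltaS D : (#|D| <= r)%N -> wt D <= delta * S.
Proof.
move=> /wt_small/le_trans; apply; rewrite ler_pM2r ?S_gt0// ler_piMr ?(ltW delta0)//.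
by rewrite exprn_ile1 ?l_le1// ltW.
Qed.

Lemma wt_12 D : (#|D| <= r)%N -> 12 * wt D <= S.
Proof.
move=> /wt_le_deltaS H; have S0 := S_gt0.
have : delta * S <= 100^-1 * S by rewrite ler_pM2r.
lra.
Qed.

Lemma nl_le_S2 : n%:R * l ^+ 2 * n%:R <= S ^+ 2.
Proof.
have -> : n%:R * l ^+ 2 * n%:R = (n%:R * l) ^+ 2 by ring.
by rewrite lerXn2r ?nnegrE ?S_ge ?(ltW S_gt0)// mulr_ge0// ltW.
Qed.

Lemma delta_S2 : 1 <= delta * S ^+ 2.
Proof.
apply: le_trans delta_nl _; rewrite ler_pM2l//; apply: le_trans nl_le_S2.
by rewrite ler_peMr ?ler1n// mulr_ge0 ?sqr_ge0.
Qed.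

Lemma card_gt0R D : (0 < #|D|)%N -> 0 < #|D|%:R :> R.
Proof. by rewrite ltr0n. Qed.

Lemma lam_le (d : nat) : (0 < d <= r)%N -> lam <= ln (n%:R / d%:R).
Proof.
move=> /andP[d0 dr]; have dp : 0 < d%:R :> R by rewrite ltr0n.
rewrite ler_ln ?posrE ?invr_gt0 ?divr_gt0 ?nR_gt0//.
rewrite ler_pdivlMr// mulrC ler_pdivrMr// mulrC; apply: le_trans r_n.
by rewrite ler_nat.
Qed.

(** The reason for scanning only [|D| >= r^(1/3)]: together with the first half of [assumption3] it
    makes [u / wt D] small, so the diagonal is negligible in [wt D ^+ 2]. *)
Lemma kappa_card D : (r%:R : R) `^ (3^-1) <= #|D|%:R -> u ^+ 2 <= delta * (#|D|%:R * l) ^+ 2.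
Proof.
move=> rD; have := kappa_r; rewrite expr_div_n ler_pdivrMr ?exprn_gt0// => /le_trans; apply.
rewrite exprMn [leRHS]mulrA ler_pM2r ?exprn_gt0// ler_pM2l//.
have -> : 2 / 3 = 3^-1 * 2%:R :> R by ring.
rewrite powRrM -powR_mulrn ?powR_ge0// !powR_mulrn ?powR_ge0//.
by rewrite lerXn2r ?nnegrE ?powR_ge0.
Qed.

Lemma card_ge2 D : (r%:R : R) `^ (3^-1) <= #|D|%:R -> (2 <= #|D|)%N.
Proof.
move=> /kappa_card uD.
have : l ^+ 2 <= delta * (#|D|%:R * l) ^+ 2.
  by apply: le_trans uD; rewrite lerXn2r ?nnegrE ?lu ?(ltW l0) ?(ltW u_gt0).
rewrite exprMn [leRHS]mulrA -[leLHS]mul1r ler_pM2r ?exprn_gt0// => H.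
case: (ltngtP #|D| 1) => // [|D1].
  by rewrite ltnS leqn0 => /eqP D0; rewrite D0 expr0n mulr0 ler10 in H.
by rewrite D1 expr1n mulr1 in H; move: H delta1; lra.
Qed.

Lemma mu0E D : wt D ^+ 2 = 2 * mu0 D + \sum_(i in D) theta i ^+ 2.
Proof. exact: sqr_sum_inside. Qed.

Lemma sum_sqr_ge0 D : 0 <= \sum_(i in D) theta i ^+ 2.
Proof. by apply: sumr_ge0 => i _; rewrite sqr_ge0. Qed.

Lemma sum_sqr_le D : \sum_(i in D) theta i ^+ 2 <= u * wt D.
Proof.
rewrite mulr_sumr; apply: ler_sum => i _; rewrite expr2 ler_wpM2r//.
by apply: le_trans (thl i); rewrite ltW.
Qed.

Lemma mu0_le D : mu0 D <= wt D ^+ 2 / 2.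
Proof. by have := mu0E D; have := sum_sqr_ge0 D; lra. Qed.

Lemma mu0_ge D : (2 <= #|D|)%N -> (#|D|%:R * l) ^+ 2 <= 4 * mu0 D.
Proof.
move=> D2; pose N : R := \sum_(e | upper e && inside D e) 1.
set k := #|D|%:R.
have HN : k ^+ 2 = 2 * N + k.
  (* Constant weights 1 turn the square identity into a count of the pairs inside [D]. *)
  have := sqr_sum_inside (fun=> 1 : R) D; rewrite [X in X ^+ 2]sumr_const -/k => ->.
  congr (2 * _ + _); first by rewrite /N; apply: eq_bigr => e _; rewrite mulr1.
  by rewrite (eq_bigr (fun=> 1 : R)) ?sumr_const// => i _; rewrite expr1n.
have k2 : 2 <= k :> R by rewrite /k (ler_nat _ 2).
have : l ^+ 2 * N <= mu0 D.
  rewrite /N mulr_sumr; apply: ler_sum => e _; rewrite mulr1 expr2 /p0.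
  by apply: ler_pM; rewrite ?(ltW l0).
rewrite exprMn.
have kk : k * 2 <= k * k by rewrite ler_wpM2l//; lra.
have : l ^+ 2 * (k ^+ 2) <= l ^+ 2 * (4 * N).
  by rewrite ler_pM2l ?exprn_gt0//; move: HN; rewrite expr2; lra.
lra.
Qed.

Lemma floor_cost D : floor_term D * (n%:R / #|D|%:R) = cost D * ln (n%:R / #|D|%:R) ^+ 3.
Proof.
rewrite /floor_term /cost; have [->|D0] := eqVneq #|D| 0%N.
  by rewrite !mul0r expr0n !mul0r.
by field; rewrite !pnatr_eq0 D0 -lt0n n0.
Qed.

Lemma across_mean0 D : edge_mean (p0 theta) (across D) = wt D * (S - wt D).
Proof.
rewrite /edge_mean -(sum_across (F := p0 theta)); last by move=> i j; rewrite /p0 mulrC.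
have -> : S - wt D = \sum_(j in ~: D) theta j.
  apply/eqP; rewrite subr_eq; apply/eqP; rewrite /wt (bigID (mem D))/= addrC.
  by congr (_ + _); apply: eq_bigl => i; rewrite !inE.
by rewrite mulr_suml; apply: eq_bigr => i _; rewrite mulr_sumr.
Qed.

Lemma p0_01 (i j : 'I_n) : (i < j)%N -> 0 <= p0 theta i j <= 1.
Proof.
move=> _; have t0 k : 0 <= theta k by apply: le_trans (thl k); rewrite ltW.
have t1 k : theta k <= 1 by apply: le_trans (thu k) u1.
by rewrite mulr_ge0//= mulr_ile1.
Qed.

Lemma cost_ge D : 1 <= lam -> (0 < #|D| <= r)%N -> 1 <= cost D.
Proof.
move=> lam1 Dr; have := lam_le Dr; rewrite /cost => lD.
have D1 : 1 <= #|D|%:R :> R by rewrite ler1n; case/andP: Dr.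
by rewrite -[leLHS]mul1r; apply: ler_pM => //; lra.
Qed.

(** What the floor buys: [cost D / (wt D * S)] is the squared relative deviation of [e(D,-D)]
    affordable in a union bound. [floor_term D <= mu0 D] bounds [wt D] below, and [n l^2 >= 1/delta]
    does the rest. *)
Lemma cost_le_sqrt D : 1 <= lam -> (0 < #|D| <= r)%N -> floor_term D <= mu0 D ->
  cost D <= Num.sqrt delta * (wt D * S).
Proof.
move=> lam1 Dr fm; have lD := lam_le Dr; have [D0 _] := andP Dr.
apply: le_sqr; first by rewrite !mulr_ge0 ?sqrtr_ge0 ?wt_ge0.
rewrite [leRHS]exprMn sqr_sqrtr ?(ltW delta0)//.
set g := ln (n%:R / #|D|%:R) in lD.
have g1 : 1 <= g by lra.
have w2 : 2 * floor_term D <= wt D ^+ 2 by have := mu0_le D; lra.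
apply: (@le_trans _ _ (delta * (2 * floor_term D * (n%:R * l ^+ 2 * n%:R)))); last first.
  rewrite ler_pM2l// exprMn; apply: ler_pM; rewrite ?nl_le_S2//.
    by rewrite !mulr_ge0 ?invr_ge0 ?exprn_ge0// -/g; lra.
  by rewrite !mulr_ge0 ?(ltW l0).
have -> : delta * (2 * floor_term D * (n%:R * l ^+ 2 * n%:R)) =
  2 * (#|D|%:R * g ^+ 2) ^+ 2 * (delta * (n%:R * l ^+ 2)).
  by rewrite /floor_term -/g; field; rewrite pnatr_eq0 -lt0n.
apply: (@le_trans _ _ (2 * (#|D|%:R * g ^+ 2) ^+ 2)); last first.
  by rewrite ler_peMr ?delta_nl// mulr_ge0 ?sqr_ge0.
have : cost D ^+ 2 <= (#|D|%:R * g ^+ 2) ^+ 2.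
  have gg : g <= g ^+ 2 by rewrite expr2 ler_peMr//; lra.
  rewrite lerXn2r ?nnegrE//; first by have := cost_ge lam1 Dr; lra.
    by rewrite mulr_ge0// sqr_ge0.
  by rewrite /cost -/g ler_wpM2l.
have := sqr_ge0 (#|D|%:R * g ^+ 2); lra.
Qed.

Lemma scan_stat_gt0 D A : 1 <= lam -> (0 < #|D| <= r)%N -> 0 < Etilde D A :> R.
Proof.
move=> lam1 Dr; have lD := lam_le Dr; have [D0 _] := andP Dr.
rewrite lt_max; apply/orP; right.
by rewrite mulr_gt0 ?divr_gt0 ?exprn_gt0 ?ltr0n//; lra.
Qed.

(** * Error under the null *)

Lemma null_deterministic eps k a b e aV aD D :
  1 <= lam -> 0 < eps -> 0 <= k <= 2^-1 -> k <= eps / 48 ->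
  4 * (k * (1 + eps / 6)) * (1 + eps / 48) <= (eps / 48) ^+ 2 ->
  (2 <= #|D| <= r)%N -> 0 <= aV -> 0 <= aD -> floor_term D <= mu0 D ->
  72 * (aV ^+ 2 + aD ^+ 2) <= k ^+ 2 ->
  72 * (aV ^+ 2 + aD ^+ 2) * mu0 D <= k * cost D ->
  a <= (1 + aV) * (S ^+ 2 / 2) ->
  (1 - aD) * (wt D * (S - wt D)) <= b -> b <= a ->
  (mu0 D <= e -> rate (mu0 D) e <= (1 + eps / 6) * cost D) ->
  forall m, ehat a b <= m -> m <= e -> rate m e < (1 + eps / 3) * cost D.
Proof.
move=> lam1 eps0 /andP[k0 k12] k1 k2 /andP[D2 Dr] aV0 aD0 fm hk hmu ha hb ba hr m em me.
have D0 : (0 < #|D|)%N by apply: leq_trans D2.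
have w0 := wt_gt0 D0; have w12 := wt_12 Dr.
(* The 6 is the loss in [ehat_ge]; [(x + y)^2 <= 2 (x^2 + y^2)] then gives the constant 72. *)
pose eta := 6 * (aV + aD).
have eta2 : eta ^+ 2 <= 72 * (aV ^+ 2 + aD ^+ 2).
  by have := sqr_ge0 (aV - aD); rewrite /eta; nra.
have eta0 : 0 <= eta by rewrite /eta; lra.
have etak : eta <= k by apply: le_sqr => //; apply: le_trans hk.
have mu_gt0 : 0 < mu0 D.
  have : 0 < (#|D|%:R * l) ^+ 2 by rewrite exprn_gt0// mulr_gt0// ltr0n.
  by have := mu0_ge D2; lra.
have c0 : 0 < cost D by apply: lt_le_trans (cost_ge lam1 _); rewrite ?ltr01 ?D0.
apply: (@rate_perturb_lt R eps k (mu0 D) (cost D) m e eta) => //.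
- by rewrite eta0 (le_trans etak).
- by apply: le_trans hmu; rewrite ler_pM2r.
apply: le_trans em.
have al : 0 <= aV + aD <= 6^-1 by apply/andP; split; move: etak k12; rewrite /eta; lra.
apply: le_trans (ehat_ge (S := S) al w0 _ _ _ ba).
- by rewrite -/eta; apply: ler_wpM2l; [move: etak k12; lra | exact: mu0_le].
- by lra.
- by apply: le_trans ha _; rewrite ler_wpM2r ?divr_ge0 ?sqr_ge0//; lra.
- apply: le_trans hb; rewrite ler_wpM2r ?mulr_ge0 ?wt_ge0//; keep w0 w12 aV0 aD0; lra.
Qed.

Lemma null_risk eps M k :
  1 <= lam -> 0 < eps -> 0 <= M -> 1 <= eps / 12 * lam -> 0 <= k <= 2^-1 ->
  k <= eps / 48 -> 4 * (k * (1 + eps / 6)) * (1 + eps / 48) <= (eps / 48) ^+ 2 ->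
  72 * (18 * M * delta + 54 * Num.sqrt delta) <= k ^+ 2 ->
  Prob (p0 theta) (scan_test r eps) <=
    expR (- M) + (2 * expR (- lam) + 2 * expR (- (eps / 12 * lam))).
Proof.
move=> lam1 eps0 M0 epslam k01 k1 k2 hk.
have S0 := S_gt0; have S20 : 0 < S ^+ 2 by rewrite exprn_gt0.
have [k0 k12] := andP k01.
have kk : k ^+ 2 <= k * 2^-1 by rewrite expr2 ler_wpM2l.
have sd0 := sqrtr_ge0 delta.
have Md0 : 0 <= M * delta by rewrite mulr_ge0// ltW.
(* [aV] and [aD] make the tail bounds [exp (- M)] and at most [exp (- 3 cost)],
   the latter beating the number of sets [D]. *)
pose aV := Num.sqrt (18 * M / S ^+ 2).
pose aD D := Num.sqrt (54 * cost D / (wt D * S)).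
have aV0 : 0 <= aV by exact: sqrtr_ge0.
have aV2 : aV ^+ 2 = 18 * M / S ^+ 2.
  by rewrite sqr_sqrtr// divr_ge0 ?(ltW S20)// mulr_ge0.
have aVd : aV ^+ 2 <= 18 * M * delta.
  rewrite aV2 ler_pdivrMr//; have := delta_S2 => H.
  have -> : 18 * M * delta * S ^+ 2 = 18 * M * (delta * S ^+ 2) by ring.
  by rewrite ler_peMr// mulr_ge0.
have aV1 : aV <= 1 by apply: le_sqr => //; rewrite expr1n; keep aVd hk kk k12 sd0; lra.
have aD2 D : (0 < #|D| <= r)%N -> aD D ^+ 2 = 54 * cost D / (wt D * S).
  move=> Dr; have := cost_ge lam1 Dr => c1.
  have c0 : 0 <= 54 * cost D by lra.
  by rewrite sqr_sqrtr// divr_ge0// mulr_ge0 ?wt_ge0.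
have aDd D : (0 < #|D| <= r)%N -> floor_term D <= mu0 D -> aD D ^+ 2 <= 54 * Num.sqrt delta.
  move=> Dr fm; rewrite aD2//; have [D0 _] := andP Dr.
  rewrite ler_pdivrMr ?(mulr_gt0 (wt_gt0 D0) S0)// -mulrA ler_pM2l//.
  exact: cost_le_sqrt.
(* Only a lower bound on the estimator is wanted, so [e(V)] must not be too large and [e(D,-D)] not
   too small. The second is asked only where the floor lies below [mu0 D], which ensures
   [aD D < 1]. *)
pose E1 : pred (graph n) := fun A =>
  (1 + aV) * (S ^+ 2 / 2) <= edge_count (inside finset.setT) A.
pose P2 : pred {set 'I_n} := fun D => (0 < #|D| <= r)%N && (floor_term D <= mu0 D).
pose F2 (D : {set 'I_n}) : pred (graph n) := fun A =>
  edge_count (across D) A <= (1 - aD D) * (wt D * (S - wt D)).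
pose P3 : pred {set 'I_n} := fun D => (2 <= #|D| <= r)%N.
pose F3 (D : {set 'I_n}) : pred (graph n) := fun A =>
  (mu0 D <= edge_count (inside D) A) &&
  ((1 + 2 * (eps / 12)) * cost D <= rate (mu0 D) (edge_count (inside D) A)).
pose E2 : pred (graph n) := fun A => [exists D, P2 D && F2 D A].
pose E3 : pred (graph n) := fun A => [exists D, P3 D && F3 D A].
have mu_gt0 D : P3 D -> 0 < mu0 D.
  move=> /andP[D2 _]; have := mu0_ge D2.
  have : 0 < (#|D|%:R * l) ^+ 2 by rewrite exprn_gt0// mulr_gt0// ltr0n ltnW.
  lra.
apply: (@le_trans _ _ (Prob (p0 theta) (fun A => E1 A || (E2 A || E3 A)))).
  apply: (Prob_subset p0_01) => A AU /existsP[D /and3P[rD Dr TD]].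
  have D2 := card_ge2 rD; have D0 : (0 < #|D|)%N by rewrite ltnW.
  have D0r : (0 < #|D| <= r)%N by rewrite D0.
  apply: contraLR TD; rewrite !negb_or => /and3P[nE1 nE2 nE3]; rewrite -ltNge.
  have c1 := cost_ge lam1 D0r; have m0 := scan_stat_gt0 A lam1 D0r.
  have e0 : 0 <= eD D A :> R := eD_ge0 _ _ _.
  rewrite /Tu ltr_pdivrMr; last by apply: lt_le_trans c1.
  rewrite -/(cost D) mul_hfunE//; have [me|me] := ltP (Etilde D A) (eD D A); last first.
    by rewrite mulr_gt0 ?(lt_le_trans ltr01 c1)//; keep eps0; lra.
  have hr : mu0 D <= eD D A -> rate (mu0 D) (eD D A) <= (1 + eps / 6) * cost D.
    move=> mue; rewrite leNgt; apply/negP => re; move/negP: nE3; apply.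
    apply/existsP; exists D; rewrite /P3 D2 Dr/= /F3 -eDE// mue/=.
    by apply: ltW; have -> : 1 + 2 * (eps / 12) = 1 + eps / 6 by field.
  have ba := eDc_le_eD R D AU.
  (* If the floor exceeds [mu0 D], so does [Etilde], and the perturbation lemma applies with no
     error at all. *)
  have [fm|fm] := lerP (floor_term D) (mu0 D); last first.
    apply: (@rate_perturb_lt R eps 0 (mu0 D) (cost D) (Etilde D A) (eD D A) 0) => //.
    - by rewrite divr_ge0// ltW.
    - by rewrite !mul0r mulr0 mul0r sqr_ge0.
    - by apply: mu_gt0; rewrite /P3 D2.
    - exact: lt_le_trans ltr01 c1.
    - by rewrite lexx invr_ge0 ler0n.
    - by rewrite expr0n !mul0r.
    - by rewrite subr0 mul1r le_max -/(floor_term D) (ltW fm) orbT.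
    - exact: ltW.
  apply: (@null_deterministic eps k (eD finset.setT A) (eDc D A) (eD D A) aV (aD D)) => //.
  - by rewrite D2.
  - exact: sqrtr_ge0.
  - by have := aDd D D0r fm; keep aVd hk; lra.
  - rewrite aD2// aV2.
    have wS := wt_le_deltaS Dr; have ml := mu0_le D; have w0 := wt_gt0 D0.
    have mug : 0 <= mu0 D by apply/ltW/mu_gt0; rewrite /P3 D2.
    have H1 : 18 * M / S ^+ 2 * mu0 D <= 9 * M * delta * cost D.
      apply: (@le_trans _ _ (18 * M / S ^+ 2 * ((delta * S) ^+ 2 / 2))).
        rewrite ler_wpM2l// -?aV2 ?sqr_ge0//; apply: le_trans ml _.
        by rewrite ler_pM2r// lerXn2r ?nnegrE ?wt_ge0// ltW// mulr_gt0.
      have -> : 18 * M / S ^+ 2 * ((delta * S) ^+ 2 / 2) = 9 * M * delta * delta.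
        by field; rewrite gt_eqF.
      rewrite ler_wpM2l//; first by keep Md0; lra.
      by apply: le_trans c1; move: delta1; keep l0; lra.
    (* Since [mu0 D <= wt D ^+ 2 / 2], only the factor [wt D / S <= delta] remains: this is
       [eta^2 mu = o(L)]. *)
    have H2 : 54 * cost D / (wt D * S) * mu0 D <= 27 * delta * cost D.
      apply: (@le_trans _ _ (54 * cost D / (wt D * S) * (wt D * (delta * S) / 2))).
        rewrite ler_wpM2l// -?aD2 ?sqr_ge0//.
        by apply: le_trans ml _; rewrite ler_pM2r// expr2 ler_pM2l.
      apply: le_of_eq; field.
      by rewrite !gt_eqF.
    have sd : delta <= Num.sqrt delta.
      apply: le_sqr => //; rewrite sqr_sqrtr ?(ltW delta0)// expr2 ler_piMr ?(ltW delta0)//.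
      by move: delta1; keep l0; lra.
    have : (72 * (9 * M * delta + 27 * delta)) * cost D <= k * cost D.
      have c0 : 0 <= cost D := ltW (lt_le_trans ltr01 c1).
      by rewrite ler_wpM2r//; keep sd hk kk Md0 k0 k12 sd0; lra.
    by keep H1 H2; lra.
  - by apply: ltW; move: nE1; rewrite /E1 -ltNge -eDE.
  - rewrite leNgt; apply/negP => hb; move/negP: nE2; apply; apply/existsP; exists D.
    by rewrite /P2 D0r fm/= /F2 -eDcE// ltW.
  - by rewrite le_max /Ehat lexx.
  - exact: ltW.
apply: le_trans (Prob_or_le p0_01 _ _) _; apply: lerD.
  apply: le_trans (Prob_edge_count_up p0_01 _ _ _) _.
  - exact: mu0_le.
  - by rewrite divr_gt0.
  - by rewrite aV0.
  rewrite ler_expR lerN2 aV2; apply: le_of_eq; field.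
  by rewrite gt_eqF.
apply: le_trans (Prob_or_le p0_01 _ _) _; apply: lerD.
  apply: le_trans (Prob_exists_le p0_01 _ _) _.
  have := @sum_subsets_expR R n r lam 1 n0 lam_le ler01.
  rewrite mul1r => /(_ lam1); apply: le_trans.
  rewrite [leLHS]big_mkcond [leRHS]big_mkcond; apply: ler_sum => D _.
  rewrite /P2; case: ifP => [/andP[Dr fm]|_]; last by case: ifP; rewrite ?expR_ge0.
  rewrite Dr; have [D0 Dr'] := andP Dr; have w0 := wt_gt0 D0; have w12 := wt_12 Dr'.
  have b0 : 0 < wt D * (S - wt D) by rewrite mulr_gt0//; keep w0 w12; lra.
  have aD01 : aD D < 1.
    rewrite ltNge; apply/negP => aD1.
    have : 1 <= aD D ^+ 2 by rewrite exprn_ege1.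
    have := aDd D Dr fm; keep hk kk k12 k0 Md0; lra.
  apply: le_trans (Prob_edge_count_lo p0_01 _ b0 _) _.
  - by rewrite across_mean0.
  - by rewrite sqrtr_ge0.
  rewrite ler_expR lerN2 aD2// -/(cost D).
  (* The last factor is at least 1 as [2 wt D <= S]; the coefficient 3 is [1 + 2 eta] in the union
     bound with [eta = 1]. *)
  rewrite [leRHS](_ : _ = 3 * cost D * (2 * (S - wt D) / S)); last by field; rewrite !gt_eqF.
  rewrite [leLHS](_ : _ = 3 * cost D * 1); last by ring.
  have c1 := cost_ge lam1 Dr.
  by rewrite ler_wpM2l ?ler_pdivlMr//; keep w0 w12 c1; lra.
apply: le_trans (Prob_exists_le p0_01 _ _) _.
have eps12 : 0 <= eps / 12 by rewrite divr_ge0// ltW.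
apply: le_trans (sum_subsets_expR n0 lam_le eps12 epslam).
rewrite [leLHS]big_mkcond [leRHS]big_mkcond; apply: ler_sum => D _.
case: ifP => [PD|_]; last by case: ifP; rewrite ?expR_ge0.
have [D2 Dr] := andP PD; rewrite (ltnW D2) Dr/=.
by apply: Prob_rate_ge => //; [exact: p0_01 | exact: mu_gt0].
Qed.

(** * Error under a planted community *)

Lemma r_ge2 : (2 <= r)%N.
Proof.
rewrite ltn_neqAle r_gt0 andbT; apply/eqP => r1.
have := le_trans kappa_ge1 kappa_r; rewrite -r1 powR1 mulr1.
by move: delta1; lra.
Qed.

Lemma edge_mean_pC_inside rho C D : D \subset C ->
  edge_mean (pC theta rho C) (inside D) = rho * mu0 D.
Proof.
move=> /fintype.subsetP DC; rewrite /mu0 /edge_mean mulr_sumr; apply: eq_bigr => e.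
by move=> /andP[_ /andP[e1 e2]]; rewrite /pC !DC.
Qed.

Lemma p0_le_pC rho C (i j : 'I_n) : 1 < rho -> p0 theta i j <= pC theta rho C i j.
Proof.
move=> r1; rewrite /pC /p0; case: ifP => // _.
by rewrite ler_peMl ?mulr_ge0 ?(le_trans (ltW l0) (thl _))// ltW.
Qed.

(** An excess edge leaves [D] for a vertex of [C] outside [D]; the weight of those vertices is
    bounded by that of all of [C]. *)
Lemma edge_mean_pC_across rho C D : 1 < rho ->
  edge_mean (pC theta rho C) (across D) <=
  wt D * (S - wt D) + (rho - 1) * (wt D * wt C).
Proof.
move=> r1; have t0 k : 0 <= theta k by apply: le_trans (thl k); rewrite ltW.
pose f (i j : 'I_n) := (rho - 1) * (theta i * if j \in C then theta j else 0).
rewrite -across_mean0 /edge_mean -!sum_across; last 2 first.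
- by move=> i j; rewrite /p0 mulrC.
- by move=> i j; rewrite /pC andbC [theta i * _]mulrC.
apply: (@le_trans _ _ (\sum_(i in D) \sum_(j in ~: D) (p0 theta i j + f i j))).
  apply: ler_sum => i _; apply: ler_sum => j _; rewrite /pC /p0 /f.
  case: (boolP (j \in C)) => jC; rewrite ?andbT ?andbF ?mulr0 ?addr0//.
  case: ifP => _; first by lra.
  by rewrite lerDl !mulr_ge0// subr_ge0 ltW.
under eq_bigr => i _ do rewrite big_split/=.
rewrite big_split/= lerD2l mulr_suml mulr_sumr; apply: ler_sum => i _.
rewrite -!mulr_sumr ler_wpM2l ?subr_ge0 ?(ltW r1)// ler_wpM2l//.
rewrite /wt big_mkcond [leRHS]big_mkcond; apply: ler_sum => j _.
by case: ifP => _; case: ifP.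
Qed.

Lemma dens_ratioE D : dens_ratio theta D = mu0 D / cost D.
Proof. by rewrite /dens_ratio Ex_eD. Qed.

Lemma lam_gt0 : 0 < lam.
Proof. by rewrite ln_gt0// invf_gt1//; move: delta1; lra. Qed.

(* Comparing [D] with the whole of [C]: a maximizer of the density is not much
   smaller than [r * (l / u) ^ 2], which dominates [r ^ (1/3)]. *)
Lemma card_maximizer C D : #|C| = r -> D \subset C -> D != finset.set0 ->
  (forall D', D' \subset C -> D' != finset.set0 ->
     dens_ratio theta D' <= dens_ratio theta D) ->
  (r%:R : R) `^ (3^-1) <= #|D|%:R.
Proof.
move=> Cr DC Dn0 Dmax; rewrite leNgt; apply/negP => Dlt.
have r2 := r_ge2; have rp := rR_gt0.
have D0 : (0 < #|D|)%N by rewrite card_gt0.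
have Dr : (#|D| <= r)%N by rewrite -Cr subset_leq_card.
have Cn0 : C != finset.set0 by rewrite -card_gt0 Cr ltnW.
have := Dmax C (fintype.subxx _) Cn0; rewrite !dens_ratioE.
have lD : lam <= ln (n%:R / #|D|%:R) by apply: lam_le; rewrite D0.
have lC : lam <= ln (n%:R / r%:R) by apply: lam_le; rewrite r_gt0/=.
have lam0 := lam_gt0; rewrite /cost Cr.
have lnCD : ln (n%:R / r%:R) <= ln (n%:R / #|D|%:R) :> R.
  rewrite ler_ln ?posrE ?divr_gt0 ?nR_gt0 ?card_gt0R// ler_pM2l ?nR_gt0//.
  by rewrite lef_pV2 ?posrE ?card_gt0R// ler_nat.
have dp := card_gt0R D0.
have muC : (r%:R * l) ^+ 2 <= 4 * mu0 C by rewrite -Cr mu0_ge ?Cr.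
have muD : mu0 D <= (#|D|%:R * u) ^+ 2 / 2.
  apply: le_trans (mu0_le D) _; rewrite ler_pM2r// lerXn2r ?nnegrE ?wt_le ?wt_ge0//.
  by rewrite mulr_ge0 ?ler0n ?(ltW u_gt0).
move: lD lC lnCD; set gD := ln (n%:R / #|D|%:R); set gC := ln (n%:R / r%:R) => lD lC lnCD.
have gC0 : 0 < gC by lra.
have gD0 : 0 < gD by lra.
rewrite ler_pdivrMr ?mulr_gt0// mulrAC ler_pdivlMr ?mulr_gt0// => H.
have H1 : (r%:R * l) ^+ 2 * (#|D|%:R * gC) <= 2 * (#|D|%:R * u) ^+ 2 * (r%:R * gC).
  apply: (@le_trans _ _ (4 * (mu0 C * (#|D|%:R * gD)))).
    rewrite [leRHS]mulrA; apply: ler_pM => //; rewrite ?sqr_ge0//.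
      by rewrite mulr_ge0// ltW.
    by rewrite ler_pM2l.
  apply: (@le_trans _ _ (4 * (mu0 D * (r%:R * gC)))); first by rewrite ler_pM2l.
  rewrite [leLHS]mulrA ler_pM2r ?mulr_gt0//; lra.
have H2 : r%:R * l ^+ 2 <= 2 * #|D|%:R * u ^+ 2.
  have p0 : 0 < r%:R * #|D|%:R * gC by rewrite !mulr_gt0.
  rewrite -(ler_pM2r p0).
  have -> : r%:R * l ^+ 2 * (r%:R * #|D|%:R * gC) = (r%:R * l) ^+ 2 * (#|D|%:R * gC) by ring.
  by apply: le_trans H1 _; apply: le_of_eq; ring.
pose c := (r%:R : R) `^ (3^-1).
have c0 : 0 < c by rewrite powR_gt0.
have c3 : c ^+ 3 = r%:R.
  by rewrite -powR_mulrn ?powR_ge0// -powRrM mulVf ?powRr1 ?ler0n// pnatr_eq0.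
have c2 : (r%:R : R) `^ (2 / 3) = c ^+ 2.
  by rewrite -powR_mulrn ?powR_ge0// -powRrM; congr (_ `^ _); ring.
have := kappa_r; rewrite c2 expr_div_n ler_pdivrMr ?exprn_gt0// => H3.
have : r%:R * l ^+ 2 < r%:R * l ^+ 2; last by rewrite ltxx.
apply: (le_lt_trans H2).
apply: (@le_lt_trans _ _ (2 * #|D|%:R * (delta * c ^+ 2 * l ^+ 2))).
  by rewrite ler_wpM2l// mulr_ge0// ltW.
apply: (@lt_le_trans _ _ (2 * c * (delta * c ^+ 2 * l ^+ 2))).
  by rewrite ltr_pM2r ?ltr_pM2l// !mulr_gt0 ?exprn_gt0.
have -> : 2 * c * (delta * c ^+ 2 * l ^+ 2) = (2 * delta) * (c ^+ 3 * l ^+ 2) by ring.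
rewrite c3 ler_piMl ?mulr_ge0 ?(ltW l0) ?ler0n//.
by move: delta1; lra.
Qed.

(** Random errors and the diagonal form [zeta], treated by [perturb_hfun_le]. The bias [b1] is
    separate: it is proportional to [delta (rho - 1) / rho], so [b1 (rho - 1) <= 8 delta h] follows
    at once. It enters [eta] as [24 b1], which gives [192 delta <= c/2]. The term [2 * b1] in the
    bound on [b] absorbs the product [b1 b2]. *)
Lemma alt_deterministic eps c k M rho D aV b1 b2 t a b e m :
  1 <= lam -> 0 < eps -> 0 <= M -> 4 * c * (1 + eps) = eps ->
  0 <= k <= 1 -> 64 * k <= (c / 2) ^+ 2 -> 384 * delta <= c ->
  90 * M <= c ^+ 2 * lam -> 4 <= c * lam -> 1024 <= c ^+ 2 * lam ->
  1 < rho -> (r%:R : R) `^ (3^-1) <= #|D|%:R -> (#|D| <= r)%N ->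
  lam <= rho * mu0 D -> (1 + eps) * cost D <= mu0 D * hfun (rho - 1) ->
  0 <= aV -> 0 <= b1 -> 0 <= b2 -> b1 * rho = 2 * delta * (rho - 1) ->
  576 * (aV ^+ 2 + (S^-1) ^+ 2 + b2 ^+ 2 + (u / wt D) ^+ 2) <= k ->
  576 * (aV ^+ 2 + (S^-1) ^+ 2 + b2 ^+ 2 + (u / wt D) ^+ 2) * mu0 D <= k * cost D ->
  0 <= t -> 2 * t <= c -> t ^+ 2 * (rho * mu0 D) = 9 * M ->
  (1 - t) * (rho * mu0 D) <= e ->
  (1 - (aV + S^-1)) * (S ^+ 2 / 2) <= a ->
  0 <= b -> b <= (1 + (b2 + 2 * b1)) * (wt D * (S - wt D)) ->
  0 < m -> m = Num.max (ehat a b) (floor_term D) ->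
  (1 + eps / 3) * cost D <= m * hfun (Num.max (e / m - 1) 0).
Proof.
move=> lam1 eps0 M0 ceps /andP[k0 k1] kc dc Mc c4 c1024 r1 rD Dr rmu muh aV0 b10 b20.
move=> b1E zk zkmu t0 tc tE he ha b0 hb m0 mE.
have D2 := card_ge2 rD; have D0 : (0 < #|D|)%N by apply: leq_trans D2.
have D0r : (0 < #|D| <= r)%N by rewrite D0.
have w0 := wt_gt0 D0; have S0 := S_gt0; have w12 := wt_12 Dr.
have c0 : 0 < c by keep ceps eps0; nra.
have cost1 := cost_ge lam1 D0r; have cost0 := lt_le_trans ltr01 cost1.
have r0 := lt_trans ltr01 r1.
have dl2 : (#|D|%:R * l) ^+ 2 <= 4 * mu0 D by apply: mu0_ge.
have dl0 : 0 < (#|D|%:R * l) ^+ 2 by rewrite exprn_gt0// mulr_gt0// ltr0n.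
have mu_gt0 : 0 < mu0 D by keep dl2 dl0; lra.
have Si0 : 0 <= S^-1 by rewrite invr_ge0 ltW.
have q0 : 0 <= u / wt D by rewrite divr_ge0 ?(ltW u_gt0) ?(ltW w0).
set q := u / wt D in zk zkmu q0 *.
pose zeta := 12 * (aV + S^-1 + b2) + 2 * q.
have zz : zeta ^+ 2 <= 576 * (aV ^+ 2 + (S^-1) ^+ 2 + b2 ^+ 2 + q ^+ 2).
  exact: sqr_zeta_le.
have zeta0 : 0 <= zeta by keep aV0 Si0 b20 q0; rewrite /zeta; lra.
have zeta1 : zeta <= 1.
  by apply: le_sqr => //; rewrite expr1n; keep zz zk k1; lra.
have b1d : b1 <= 2 * delta.
  by rewrite -(ler_pM2r r0) b1E ler_pM2l ?mulr_gt0//; keep r1; lra.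
have hz : zeta * (rho - 1) <= c / 2 * hfun (rho - 1).
  apply: (@perturb_hfun_le R k (c / 2) (mu0 D) (cost D)) => //.
  - by rewrite divr_gt0.
  - exact: le_trans zz zk.
  - by apply: le_trans zkmu; rewrite ler_pM2r.
  - by apply: le_trans muh; rewrite ler_peMl ?(ltW cost0)//; keep eps0; lra.
have hb1 : b1 * (rho - 1) <= 8 * delta * hfun (rho - 1).
  rewrite -(ler_pM2r r0) mulrAC b1E.
  have -> : 2 * delta * (rho - 1) * (rho - 1) = 2 * delta * (rho - 1) ^+ 2 by ring.
  have -> : 8 * delta * hfun (rho - 1) * rho = 2 * delta * (4 * rho * hfun (rho - 1)) by ring.
  by rewrite ler_pM2l ?mulr_gt0// sqr_sub1_le_hfun// ltW.
pose eta := zeta + 24 * b1.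
have h0 : 0 <= hfun (rho - 1) by rewrite hfun_ge0// ltW.
have heta : eta * (rho - 1) <= c * hfun (rho - 1).
  have : 384 * delta * hfun (rho - 1) <= c * hfun (rho - 1) by rewrite ler_wpM2r.
  by keep hz hb1; rewrite /eta; lra.
have d1 := delta1.
have hehat : ehat a b <= (1 + eta) * mu0 D.
  apply: le_trans (ehat_le (S := S) (s := wt D) (al := aV + S^-1)
    (be := b2 + 2 * b1) _ _ _ _ _ ha b0 hb) _ => //.
  - by keep zeta1 aV0 b20 q0 Si0; apply/andP; move: zeta1; rewrite /zeta; split; lra.
  - by keep b10 b20; lra.
  - by keep zeta1 aV0 b20 q0 Si0 b1d d1; move: zeta1; rewrite /zeta; lra.
  have -> : eta = 12 * (aV + S^-1 + (b2 + 2 * b1)) + 2 * q by rewrite /eta /zeta; ring.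
  apply: (ehat_mean_le (y := \sum_(i in D) theta i ^+ 2)) => //.
  - by keep zeta1 aV0 b20 q0 Si0; move: zeta1; rewrite q0 /zeta; lra.
  - exact: sqr_ge0.
  - apply: le_trans (sum_sqr_le D) _.
    have -> // : u * wt D = q * wt D ^+ 2 by rewrite /q; field; rewrite gt_eqF.
  - exact: mu0E.
  - by keep aV0 Si0 b10 b20; lra.
  - exact: ltW.
pose x := t * (rho * mu0 D).
have pm0 : 0 < rho * mu0 D by rewrite mulr_gt0.
have e0 : 0 <= e.
  apply: le_trans he; rewrite mulr_ge0 ?(ltW pm0)//; keep tc ceps eps0 c0 t0; nra.
have [small|large] := lerP m ((1 + eta) * mu0 D).
  apply: (@alt_small R c (mu0 D) rho (cost D) m e x eta eps) => //.
    by keep he; rewrite /x; lra.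
  apply: (@dev_ln_le R c lam M) => //.
  - by rewrite /x mulr_ge0 ?(ltW pm0).
  - exact: lt_le_trans ltr01 lam1.
  - have -> : x ^+ 2 = t ^+ 2 * (rho * mu0 D) * (rho * mu0 D) by rewrite /x; ring.
    by rewrite tE.
  - have := lam_le D0r; rewrite /cost in muh cost0 cost1 * => lD.
    apply: le_trans muh; have D1 : 1 <= #|D|%:R :> R by rewrite ler1n.
    have : lam * 1 <= ln (n%:R / #|D|%:R) * #|D|%:R by apply: ler_pM => //; keep lam1; lra.
    have : cost D <= (1 + eps) * cost D by rewrite ler_peMl ?(ltW cost0)//; keep eps0; lra.
    by keep l0; rewrite /cost; lra.
have mB : m = floor_term D.
  move: large; rewrite mE lt_max ltNge hehat/= => fl.
  by rewrite max_r// ltW// (le_lt_trans hehat).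
rewrite {}mB in large m0 mE *.
have eta0 : 0 <= eta by keep zeta0 b10; rewrite /eta; lra.
apply: (@alt_large R c (mu0 D) rho (cost D) (floor_term D) e t eps (n%:R / #|D|%:R) lam) => //.
- by rewrite divr_gt0 ?nR_gt0// ltr0n.
- exact: lam_le.
- exact: floor_cost.
- by apply: le_lt_trans large; rewrite ler_peMl ?(ltW mu_gt0)//; keep eta0; lra.
- rewrite /floor_term mulrC ler_wpM2l//.
    by rewrite exprn_ge0//; have := lam_le D0r; keep lam1; lra.
  rewrite ler_pdivrMr ?nR_gt0//.
  apply: (@le_trans _ _ (#|D|%:R ^+ 2 * (delta * (n%:R * l ^+ 2)))).
    by rewrite ler_peMr ?sqr_ge0 ?delta_nl.
  have -> : #|D|%:R ^+ 2 * (delta * (n%:R * l ^+ 2)) =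
    delta * n%:R * (#|D|%:R * l) ^+ 2 by ring.
  apply: (@le_trans _ _ (delta * n%:R * (4 * mu0 D))).
    by rewrite ler_wpM2l// mulr_ge0// ltW.
  have -> : delta * n%:R * (4 * mu0 D) = (4 * delta) * (mu0 D * n%:R) by ring.
  by rewrite ler_piMl ?mulr_ge0 ?(ltW mu_gt0)//; keep d1; lra.
Qed.

Lemma alt_risk eps c k M rho C D :
  1 <= lam -> 0 < eps -> 0 <= M -> 4 * c * (1 + eps) = eps ->
  0 <= k <= 1 -> 64 * k <= (c / 2) ^+ 2 -> 384 * delta <= c ->
  90 * M <= c ^+ 2 * lam -> 4 <= c * lam -> 1024 <= c ^+ 2 * lam ->
  576 * (54 * M + 2) * delta <= k -> 576 * (27 * M * delta + 1) <= k * lam ->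
  36 * M * delta <= c ^+ 2 ->
  1 < rho -> #|C| = r ->
  (forall i j, i \in C -> j \in C -> i != j -> rho * (theta i * theta j) <= 1) ->
  D \subset C -> D != finset.set0 ->
  (forall D', D' \subset C -> D' != finset.set0 ->
     dens_ratio theta D' <= dens_ratio theta D) ->
  delta^-1 <= Ex (pC theta rho C) (eD D) ->
  (exists D', [/\ D' \subset C, D' != finset.set0 &
       1 + eps <= Ex (p0 theta) (eD D') * hfun (rho - 1)
                  / (#|D'|%:R * ln (n%:R / #|D'|%:R))]) ->
  Prob (pC theta rho C) (fun A => ~~ scan_test r eps A) <= 3 * expR (- M).
Proof.
move=> lam1 eps0 M0 ceps k01 kc dc Mc c4 c1024 Mk Mk2 Mdc r1 Cr rC DC Dn0 Dmax hE hC.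
have [k0 k1] := andP k01.
have rD := card_maximizer Cr DC Dn0 Dmax.
have Dr : (#|D| <= r)%N by rewrite -Cr subset_leq_card.
have D2 := card_ge2 rD; have D0 : (0 < #|D|)%N by apply: leq_trans D2.
have D0r : (0 < #|D| <= r)%N by rewrite D0.
have w0 := wt_gt0 D0; have S0 := S_gt0; have w12 := wt_12 Dr.
have S20 : 0 < S ^+ 2 by rewrite exprn_gt0.
have d1 := delta1; have dS := delta_S2.
have h0 : 0 <= hfun (rho - 1) by rewrite hfun_ge0// ltW.
have c0 : 0 < c by keep ceps eps0; nra.
have c14 : c <= 4^-1 by keep ceps eps0 c0; nra.
have cost1 := cost_ge lam1 D0r; have cost0 := lt_le_trans ltr01 cost1.
have Md0 : 0 <= M * delta by rewrite mulr_ge0// ltW.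
have cc : c ^+ 2 <= 16^-1 by keep c0 c14; nra.
(* [h(rho - 1)] does not depend on the subset, so the bound known for some [D'] passes to the
   maximizer of the density. *)
have muh : (1 + eps) * cost D <= mu0 D * hfun (rho - 1).
  have [D' [D'C D'n0 H]] := hC; rewrite -ler_pdivlMr//; apply: le_trans H _.
  rewrite Ex_eD mulrAC [leRHS]mulrAC ler_wpM2r//.
  by have := Dmax D' D'C D'n0; rewrite !dens_ratioE.
have r0 := lt_trans ltr01 r1.
have mean_e : edge_mean (pC theta rho C) (inside D) = rho * mu0 D.
  exact: edge_mean_pC_inside.
have rmu : delta^-1 <= rho * mu0 D by rewrite -mean_e -Ex_eD.
have di0 : 0 < delta^-1 by rewrite invr_gt0.
have pm0 := lt_le_trans di0 rmu.
have pmd : 1 <= delta * (rho * mu0 D).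
  by rewrite -(mulfV (lt0r_neq0 delta0)) ler_pM2l.
have q01 (i j : 'I_n) : (i < j)%N -> 0 <= pC theta rho C i j <= 1.
  move=> ij; rewrite /pC; case: ifP => [/andP[iC jC]|_]; last exact: p0_01 ij.
  rewrite rC//; last by apply/eqP => ji; rewrite ji ltnn in ij.
  by rewrite !mulr_ge0 ?(le_trans (ltW l0) (thl _))// ltW.
(* Read off any two distinct vertices of [C], which exist because [r >= 2]. *)
have rl2 : rho * l ^+ 2 <= 1.
  have : (1 < #|C|)%N by rewrite Cr r_ge2.
  move=> /card_gt1P[i [j [iC jC ij]]]; apply: le_trans (rC i j iC jC ij).
  by rewrite ler_pM2l// expr2; apply: ler_pM; rewrite ?(ltW l0).
(* [t], [aV] and [b2] are the relative deviations whose probability is at most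
   [exp (- M)]; [b1] bounds the effect of the planted community on [e(D,-D)]. *)
pose t := Num.sqrt (9 * M / (rho * mu0 D)).
have t0 : 0 <= t by exact: sqrtr_ge0.
have t2 : t ^+ 2 = 9 * M / (rho * mu0 D).
  by rewrite sqr_sqrtr// divr_ge0 ?(ltW pm0)// mulr_ge0.
have tE : t ^+ 2 * (rho * mu0 D) = 9 * M by rewrite t2 divfK// gt_eqF.
have t2d : t ^+ 2 <= 9 * M * delta.
  rewrite t2 ler_pdivrMr//.
  have -> : 9 * M * delta * (rho * mu0 D) = 9 * M * (delta * (rho * mu0 D)) by ring.
  by rewrite ler_peMr// mulr_ge0.
have tc : 2 * t <= c by apply: le_sqr; [exact: ltW | rewrite exprMn; keep t2d Mdc; lra].
have t1 : t < 1 by keep tc c14; lra.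
pose aV := Num.sqrt (36 * M / S ^+ 2).
have aV0 : 0 <= aV by exact: sqrtr_ge0.
have aV2 : aV ^+ 2 = 36 * M / S ^+ 2.
  by rewrite sqr_sqrtr// divr_ge0 ?(ltW S20)// mulr_ge0.
have aVd : aV ^+ 2 <= 36 * M * delta.
  rewrite aV2 ler_pdivrMr//.
  have -> : 36 * M * delta * S ^+ 2 = 36 * M * (delta * S ^+ 2) by ring.
  by rewrite ler_peMr// mulr_ge0.
have aV1 : aV < 1 by keep aV0 aVd Mdc cc; nra.
have wS : 1 <= delta * (wt D * S).
  apply: le_trans delta_nl _; rewrite ler_pM2l//.
  have -> : n%:R * l ^+ 2 = l * (n%:R * l) by ring.
  apply: ler_pM; rewrite ?S_ge ?(ltW l0) ?mulr_ge0 ?(ltW l0)//.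
  by apply: le_trans (wt_ge D); rewrite ler_peMl ?(ltW l0)// ler1n.
have wS0 : 0 < wt D * S by rewrite mulr_gt0.
pose b2 := Num.sqrt (18 * M / (wt D * S)).
have b20 : 0 <= b2 by exact: sqrtr_ge0.
have b22 : b2 ^+ 2 = 18 * M / (wt D * S).
  by rewrite sqr_sqrtr// divr_ge0 ?(ltW wS0)// mulr_ge0.
have b2d : b2 ^+ 2 <= 18 * M * delta.
  rewrite b22 ler_pdivrMr//.
  have -> : 18 * M * delta * (wt D * S) = 18 * M * (delta * (wt D * S)) by ring.
  by rewrite ler_peMr// mulr_ge0.
have b21 : b2 <= 1 by apply: le_sqr => //; rewrite expr1n; keep b2d Mdc cc; lra.
pose b1 := 2 * delta * (rho - 1) / rho.
have b1E : b1 * rho = 2 * delta * (rho - 1) by rewrite /b1 divfK// gt_eqF.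
have b10 : 0 <= b1 by rewrite /b1 divr_ge0 ?(ltW r0)// !mulr_ge0 ?(ltW delta0)//; keep r1; lra.
have Sd : (S^-1) ^+ 2 <= delta.
  by rewrite exprVn -[leLHS]mul1r ler_pdivrMr.
have ud : (u / wt D) ^+ 2 <= delta.
  rewrite expr_div_n ler_pdivrMr ?exprn_gt0//; apply: le_trans (kappa_card rD) _.
  by rewrite ler_pM2l// lerXn2r ?nnegrE ?wt_ge ?wt_ge0// mulr_ge0// ltW.
have mu_gt0 : 0 < mu0 D by move: pm0; rewrite pmulr_rgt0.
have ml := mu0_le D; have wdS := wt_le_deltaS Dr.
have w2S : wt D ^+ 2 <= delta * S ^+ 2.
  apply: (@le_trans _ _ ((delta * S) ^+ 2)).
    by rewrite lerXn2r ?nnegrE ?wt_ge0// ltW// mulr_gt0.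
  by rewrite exprMn ler_pM2r// expr2 ler_piMl ?(ltW delta0)//; keep d1; lra.
(* [(S^2 - S)/2]: the squared weights sum to at most [S]. Planting only raises the mean of [e(V)],
   so the null bound is enough. *)
pose ma := (1 - S^-1) * (S ^+ 2 / 2).
have Si0 : 0 <= S^-1 by rewrite invr_ge0 ltW.
have Si : S^-1 <= 10^-1.
  apply: le_sqr; first by rewrite invr_ge0.
  by apply: le_trans Sd _; keep d1; lra.
have ma0 : 0 < ma by rewrite mulr_gt0 ?divr_gt0//; keep Si; lra.
have mean_a : ma <= edge_mean (pC theta rho C) (inside finset.setT).
  apply: (@le_trans _ _ (mu0 finset.setT)); last first.
    by apply: ler_sum => e _; exact: p0_le_pC.
  have := mu0E finset.setT; have := sum_sqr_le finset.setT => H1 H2.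
  have : u * S <= 1 * S by rewrite ler_pM2r// u1.
  have -> : ma = (S ^+ 2 - S) / 2 by rewrite /ma; field; rewrite gt_eqF.
  by keep H1 H2; lra.
pose mb := (1 + b1) * (wt D * (S - wt D)).
have wSw0 : 0 < wt D * (S - wt D) by rewrite mulr_gt0//; keep w0 w12; lra.
have mb0 : 0 < mb by rewrite mulr_gt0//; keep b10; lra.
have mean_b : edge_mean (pC theta rho C) (across D) <= mb.
  apply: le_trans (edge_mean_pC_across _ _ r1) _.
  (* After multiplication by [rho] and cancellation, the claim is [rho wt C <= 2 delta (S - wt D)],
     from [wt C <= delta l^2 S] and [rho l^2 <= 1]. *)
  rewrite /mb [leRHS]mulrDl mul1r lerD2l.
  have Cle : (#|C| <= r)%N by rewrite Cr.
  have -> : (rho - 1) * (wt D * wt C) = wt D * ((rho - 1) * wt C) by ring.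
  have -> : b1 * (wt D * (S - wt D)) = wt D * (b1 * (S - wt D)) by ring.
  rewrite ler_pM2l// -(ler_pM2l r0).
  have -> : rho * (b1 * (S - wt D)) = (rho - 1) * (delta * (2 * (S - wt D))).
    transitivity (b1 * rho * (S - wt D)); last by rewrite b1E; ring.
    by rewrite mulrA [b1 * rho]mulrC.
  rewrite mulrCA ler_pM2l ?subr_gt0//.
  apply: (@le_trans _ _ (rho * (delta * l ^+ 2 * S))).
    by rewrite ler_pM2l// wt_small.
  have -> : rho * (delta * l ^+ 2 * S) = (rho * l ^+ 2) * (delta * S) by ring.
  apply: (@le_trans _ _ (delta * S)).
    by rewrite ler_piMl// mulr_ge0// ltW.
  by rewrite ler_pM2l//; keep w0 w12; lra.
pose E1 : pred (graph n) := fun A =>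
  edge_count (inside D) A <= (1 - t) * (rho * mu0 D).
pose E2 : pred (graph n) := fun A =>
  edge_count (inside finset.setT) A <= (1 - aV) * ma.
pose E3 : pred (graph n) := fun A => (1 + b2) * mb <= edge_count (across D) A.
apply: (@le_trans _ _ (Prob (pC theta rho C) (fun A => E1 A || (E2 A || E3 A)))).
  apply: (Prob_subset q01) => A AU; apply: contraNT; rewrite !negb_or.
  rewrite /E1 /E2 /E3 -!ltNge -!eDE// -eDcE// => /and3P[nE1 nE2 nE3].
  apply/existsP; exists D; rewrite rD Dr/=.
  rewrite /Tu ler_pdivlMr// -/(cost D).
  apply: (@alt_deterministic eps c k M rho D aV b1 b2 t (eD finset.setT A) (eDc D A)) => //.
  - by apply: le_trans rmu; apply/ltW/ln_sublinear.
  - by keep aVd Sd b2d ud Mk; lra.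
  - have H1 : aV ^+ 2 * mu0 D <= 18 * M * delta.
      apply: (@le_trans _ _ (aV ^+ 2 * (delta * S ^+ 2 / 2))).
        by rewrite ler_wpM2l ?sqr_ge0//; keep ml w2S; lra.
      by rewrite aV2; apply: le_of_eq; field; rewrite gt_eqF.
    have H2 : (S^-1) ^+ 2 * mu0 D <= delta / 2.
      apply: (@le_trans _ _ ((S^-1) ^+ 2 * (delta * S ^+ 2 / 2))).
        by rewrite ler_wpM2l ?sqr_ge0//; keep ml w2S; lra.
      by apply: le_of_eq; field; rewrite gt_eqF.
    have H3 : b2 ^+ 2 * mu0 D <= 9 * M * delta.
      apply: (@le_trans _ _ (b2 ^+ 2 * (wt D * (delta * S) / 2))).
        rewrite ler_wpM2l ?sqr_ge0//; apply: le_trans ml _.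
        by rewrite ler_pM2r// expr2 ler_pM2l.
      by rewrite b22; apply: le_of_eq; field; rewrite !gt_eqF.
    (* The only error here that [delta] does not shrink: it is a constant, absorbed because
       [cost D >= lam]. *)
    have H4 : (u / wt D) ^+ 2 * mu0 D <= 2^-1.
      apply: (@le_trans _ _ ((u / wt D) ^+ 2 * (wt D ^+ 2 / 2))).
        by rewrite ler_wpM2l ?sqr_ge0.
      rewrite expr_div_n mulrA divfK ?gt_eqF ?exprn_gt0//.
      by rewrite ler_piMl// exprn_ile1 ?(ltW u_gt0).
    have H5 : k * lam <= k * cost D.
      rewrite ler_wpM2l// /cost; have lD := lam_le D0r.
      have D1 : 1 <= #|D|%:R :> R by rewrite ler1n.
      by rewrite -[leLHS]mul1r; apply: ler_pM => //; keep lam1; lra.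
    by keep H1 H2 H3 H4 H5 Mk2 d1 Md0; lra.
  - exact: ltW.
  - apply: le_trans (ltW nE2); rewrite /ma [leRHS]mulrA ler_wpM2r ?divr_ge0 ?(ltW S20)//.
    by have : 0 <= aV * S^-1 by [rewrite mulr_ge0]; keep l0; lra.
  - exact: eDc_ge0.
  - apply: le_trans (ltW nE3) _; rewrite /mb [leLHS]mulrA ler_wpM2r ?(ltW wSw0)//.
    by have : b1 * b2 <= b1 * 1 by [rewrite ler_wpM2l]; keep l0; lra.
  - exact: scan_stat_gt0.
have -> : 3 * expR (- M) = expR (- M) + (expR (- M) + expR (- M)) by ring.
apply: le_trans (Prob_or_le q01 _ _) _; apply: lerD.
  apply: le_trans (Prob_edge_count_lo q01 (t := t) _ pm0 _) _.
  - by rewrite mean_e.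
  - by rewrite t0.
  by rewrite ler_expR lerN2 tE; keep l0; lra.
apply: le_trans (Prob_or_le q01 _ _) _; apply: lerD.
  apply: le_trans (Prob_edge_count_lo q01 mean_a ma0 _) _; first by rewrite aV0.
  rewrite ler_expR lerN2 aV2.
  have -> : 36 * M / S ^+ 2 * ma / 9 = M * (2 * (1 - S^-1)).
    by rewrite /ma; field; rewrite gt_eqF.
  by rewrite ler_peMr//; keep Si; lra.
apply: le_trans (Prob_edge_count_up q01 mean_b mb0 _) _; first by rewrite b20.
rewrite ler_expR lerN2 b22.
have -> : 18 * M / (wt D * S) * mb / 9 = M * ((1 + b1) * (2 * (S - wt D) / S)).
  by rewrite /mb; field; rewrite !gt_eqF.
rewrite ler_peMr//.
have : 1 <= 2 * (S - wt D) / S by rewrite ler_pdivlMr//; keep w12 w0; lra.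
by keep b10; nra.
Qed.

End Regime.

(** * Consistency *)

Section Constants.
Variable R : realType.

Lemma near_pinfty_mul_ge (x w : R) : 0 < w -> \forall L \near +oo, x <= w * L.
Proof.
move=> w0; near=> L; rewrite -ler_pdivrMl// mulrC.
Unshelve. all: by end_near. Qed.

Lemma expRN_le_inv (x : R) : 0 < x -> expR (- x) <= x^-1.
Proof.
move=> x0; rewrite expRN lef_pV2 ?posrE ?expR_gt0//.
by apply: le_trans (expR_ge1Dx _); rewrite lerDr.
Qed.

Lemma sqrt_expRN_le (x : R) : 0 < x -> Num.sqrt (expR (- x)) <= 2 / x.
Proof.
move=> x0; have -> : Num.sqrt (expR (- x)) = expR (- (x / 2)).
  rewrite -[RHS]ger0_norm ?expR_ge0// -sqrtr_sqr -expRM_natl.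
  by congr (Num.sqrt (expR _)); field.
by apply: le_trans (expRN_le_inv _) _; rewrite ?divr_gt0// invf_div.
Qed.

Lemma rate_margin_exists (eps : R) : 0 < eps -> exists k : R,
  [/\ 0 < k, k <= 2^-1, k <= eps / 48 &
      4 * (k * (1 + eps / 6)) * (1 + eps / 48) <= (eps / 48) ^+ 2].
Proof.
move=> eps0; pose w := 4 * (1 + eps / 6) * (1 + eps / 48).
have w0 : 0 < w by rewrite !mulr_gt0//; lra.
exists (Num.min 2^-1 (Num.min (eps / 48) ((eps / 48) ^+ 2 / w))).
have e48 : 0 < eps / 48 by rewrite divr_gt0.
split; rewrite ?lt_min ?ge_min ?lexx ?orbT//.
  by rewrite e48 invr_gt0 divr_gt0 ?exprn_gt0// ltr0n.
set k := Num.min _ _.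
have -> : 4 * (k * (1 + eps / 6)) * (1 + eps / 48) = k * w by rewrite /w; ring.
by rewrite -ler_pdivlMr// /k !ge_min lexx !orbT.
Qed.

End Constants.

Section Extrema.
Variables (R : realType) (n : nat) (theta : 'I_n -> R).
Hypothesis theta01 : forall i, 0 < theta i < 1.

Lemma theta_min_gt0 : 0 < theta_min theta.
Proof. by apply/bigmin_gtP; split => // i _; case/andP: (theta01 i). Qed.

Lemma theta_min_le i : theta_min theta <= theta i.
Proof. exact: bigmin_inf. Qed.

Lemma theta_max_ge i : theta i <= theta_max theta.
Proof. exact: le_bigmax. Qed.

Lemma theta_max_le1 : theta_max theta <= 1.
Proof. by apply: bigmax_le => // i _; apply: ltW; case/andP: (theta01 i). Qed.

End Extrema.

Theorem theorem3 (R : realType) (theta : forall n, 'I_n -> R) (r : nat -> nat)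
    (rho : forall n, {set 'I_n} -> R)
    (Dstar : forall n, {set 'I_n} -> {set 'I_n}) (eps : R) :
  0 < eps ->
  (forall n (i : 'I_n), 0 < theta n i < 1) ->
  (forall n (C : {set 'I_n}), #|C| = r n -> 1 < rho n C) ->
  (forall n (C : {set 'I_n}) (i j : 'I_n), #|C| = r n -> i \in C -> j \in C ->
     i != j -> rho n C * (theta n i * theta n j) <= 1) ->
  assumption3 theta r ->
  (* D*_C is a maximizer of E_0[e(D)]/(|D| log(n/|D|)) over nonempty D subset C *)
  (forall n (C : {set 'I_n}), #|C| = r n ->
     [/\ Dstar n C \subset C, Dstar n C != finset.set0 &
         forall D : {set 'I_n}, D \subset C -> D != finset.set0 ->
           dens_ratio (theta n) D <= dens_ratio (theta n) (Dstar n C)]) ->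
  (* r = o(n) *)
  little_o (fun n => (r n)%:R : R) (fun n => n%:R : R) ->
  (* E_C[e(D*_C)] -> oo, uniformly over |C| = r *)
  (forall M : R, \forall n \near \oo, forall C : {set 'I_n}, #|C| = r n ->
     M <= Ex (pC (theta n) (rho n C) C) (eD (Dstar n C))) ->
  (* max over nonempty D subset C of E_0[e(D)] h(rho_C - 1)/(|D| log(n/|D|)) >= 1 + eps *)
  (forall n (C : {set 'I_n}), #|C| = r n ->
     exists D : {set 'I_n}, [/\ D \subset C, D != finset.set0 &
       1 + eps <= Ex (p0 (theta n)) (eD D) * hfun (rho n C - 1)
                  / (#|D|%:R * ln (n%:R / #|D|%:R))]) ->
  (fun n : nat => @risk R n (theta n) (r n) (rho n) (@scan_test R n (r n) eps)) @ \oo --> (0 : R).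
Proof.
move=> eps0 th01 rho1 rhole ass3 Dmax rn EC hC.
(* Order of choice: [tau] fixes [M], then [L] is taken large in terms of [M] and [eps],
   [delta = exp (- L)], and finally [n] is large in terms of [delta]. *)
apply/cvgr0Pnorm_le => tau tau0.
have [k [k0 k12 k48 kE]] := rate_margin_exists eps0.
pose c := eps / (4 * (1 + eps)).
have eps1 : 0 < 1 + eps by lra.
have c0 : 0 < c by rewrite divr_gt0// mulr_gt0.
have cE : 4 * c * (1 + eps) = eps by rewrite /c; field; rewrite gt_eqF.
have c1 : c <= 4^-1 by nra.
(* Chosen so that [64 kc = (c/2)^2]; [k] is the perturbation margin of the null, [kc] that of the
   alternative. *)
pose kc := c ^+ 2 / 256.
have kc0 : 0 < kc by rewrite divr_gt0 ?exprn_gt0 ?ltr0n.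
pose M := 8 / tau.
have M0 : 0 < M by rewrite divr_gt0.
have e12 : 0 < eps / 12 by rewrite divr_gt0.
(* All requirements are linear in [L], since [delta <= 1/L] and [sqrt delta <= 2/L]; the 108 is 54
   times 2. *)
have /filter_ex [L [[L1 L2 L3 L4] [L5 L6 L7 L8]]] : \forall L \near +oo,
    [/\ 100 <= 1 * L, 1 <= eps / 12 * L, M <= eps / 12 * L & M <= 1 * L] /\
    [/\ 72 * (18 * M + 108) <= k ^+ 2 * L, 90 * M <= c ^+ 2 * L,
        1024 <= c ^+ 2 * L & 576 * (54 * M + 2) <= kc * L].
  by near=> L; do !split; near: L; apply: near_pinfty_mul_ge; rewrite ?exprn_gt0.
rewrite !mul1r in L1 L4.
have L0 : 0 < L by lra.
pose delta := expR (- L).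
have delta0 : 0 < delta by exact: expR_gt0.
have lamE : ln delta^-1 = L by rewrite /delta -expRN opprK expRK.
have dL : delta * L <= 1.
  by rewrite -ler_pdivlMr// mul1r; exact: expRN_le_inv.
have delta1 : delta <= 100^-1.
  by apply: le_trans (expRN_le_inv L0) _; rewrite lef_pV2 ?posrE.
have dmul (x w : R) : 0 <= w -> x <= w * L -> x * delta <= w.
  move=> w0 xw; apply: (@le_trans _ _ (w * L * delta)); first by rewrite ler_pM2r.
  by rewrite -mulrA [L * _]mulrC ler_piMr.
have cc : c ^+ 2 * L <= 4^-1 * (c * L).
  by rewrite expr2 -mulrA ler_pM2r// mulr_gt0.
have kck : kc <= 1 by clear -c0 c1; rewrite /kc; nra.
near=> n.
have n0 : (0 < n)%N by near: n; exact: nbhs_infty_gt.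
have H3 : (r n)%:R <= delta * n%:R by near: n; exact: rn.
have /andP[H1 H2] : ((theta_max (theta n) / theta_min (theta n)) ^+ 2 <=
    delta * ((r n)%:R : R) `^ (2 / 3)) &&
  ((theta_max (theta n) / theta_min (theta n)) ^+ 2 <=
    delta * ((n%:R / (r n)%:R) * theta_min (theta n) ^+ 2)).
  rewrite -le_min -minr_pMr ?(ltW delta0)//.
  by near: n; exact: ass3.
have HE : forall C : {set 'I_n}, #|C| = r n ->
    delta^-1 <= Ex (pC (theta n) (rho n C) C) (eD (Dstar n C)).
  by near: n; exact: EC.
have t0 := theta_min_gt0 (th01 n).
have tl := @theta_min_le R n (theta n).
have tu := @theta_max_ge R n (theta n).
have tu1 := theta_max_le1 (th01 n).
have null : Prob (p0 (theta n)) (@scan_test R n (r n) eps) <=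
    expR (- M) + (2 * expR (- L) + 2 * expR (- (eps / 12 * L))).
  rewrite -lamE; apply: (null_risk n0 t0 tl tu tu1 delta0 delta1 H1 H2 H3 (k := k)) => //.
  - by rewrite lamE; clear -L1; lra.
  - exact: ltW.
  - by rewrite lamE.
  - by rewrite ltW.
  - have sd : Num.sqrt delta <= 2 / L by exact: sqrt_expRN_le.
    have Md : M * delta <= M * L^-1 by rewrite ler_pM2l//; exact: expRN_le_inv.
    move: L5; rewrite -ler_pdivrMr// => L5; apply: le_trans L5.
    by clear -sd Md; lra.
have alt (C : {set 'I_n}) : #|C| = r n ->
    Prob (pC (theta n) (rho n C) C) (fun A => ~~ @scan_test R n (r n) eps A) <=
    3 * expR (- M).
  move=> Cr; have [DC Dn0 DM] := Dmax n C Cr.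
  apply: (alt_risk n0 t0 tl tu tu1 delta0 delta1 H1 H2 H3 (c := c) (k := kc)
    (D := Dstar n C)) => //; rewrite ?lamE//.
  - by clear -L1; lra.
  - exact: ltW.
  - by rewrite ltW.
  - by clear; rewrite /kc; lra.
  - by apply: dmul; [exact: ltW | clear -cc L7; lra].
  - by clear -cc L7; lra.
  - by apply: dmul => //; exact: ltW.
  - apply: le_trans L8.
    have : M * delta <= M * 1 by rewrite ler_pM2l//; clear -delta1; lra.
    by clear -M0; lra.
  - by apply: dmul; [exact: sqr_ge0 | clear -L6 M0; lra].
  - exact: rho1.
  - by move=> i j; exact: rhole.
  - exact: HE.
  - exact: hC.
have p01 := p0_01 t0 tl tu tu1.
have expM x : M <= x -> expR (- x) <= tau / 8.
  move=> Mx; have x0 : 0 < x by apply: lt_le_trans Mx.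
  apply: le_trans (expRN_le_inv x0) _.
  by rewrite -[leRHS]invf_div lef_pV2 ?posrE.
rewrite ger0_norm; last first.
  by rewrite addr_ge0 ?(Prob_ge0 p01)//; exact: bigmax_ge_id.
have E1 := expM _ (lexx M); have E2 := expM _ L4; have E3 := expM _ L3.
(* The null bound has 1 + 2 + 2 exponentials and the alternative 3, each at most [tau / 8]. *)
have -> : tau = tau * 5 / 8 + tau * 3 / 8 by field.
rewrite /risk; apply: lerD; first by apply: le_trans null _; clear -E1 E2 E3; lra.
apply: bigmax_le => [|C /eqP Cr]; first by clear -tau0; lra.
by apply: le_trans (alt C Cr) _; clear -E1; lra.
Unshelve. all: by end_near. Qed.
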